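(* Let $M$ be a smooth manifold of dimension $n$ and let $F=\sqrt[3]{a_{ijk}(x)y^iy^jy^k}$ be a cubic Finsler metric on $M$, where the coefficients $a_{ijk}=a_{ijk}(x)$ are symmetric in all their indices. If the functions $a_{ijk}$ are of class at least $C^1$, then the following implication holds: if $(M,F)$ is a Landsberg space, then $(M,F)$ is a Berwald space.
   Context: Let $M$ be a smooth manifold and $(x^i,y^i)$ the induced local coordinates on $TM$. Finsler spaces are understood in the wider sense: $F$ is considered on an open conic subset of $TM\setminus 0$ (having nonempty intersection with each tangent space) on which $F\neq 0$, $F$ is smooth in $y$, and the Finsler metric tensor $g_{ij}=\frac12\frac{\partial^2F^2}{\partial y^i\partial y^j}$ is nondegenerate (no positive-definiteness required). Notation: - $g^{ij}$ is the inverse of $g_{ij}$. - The canonical spray coefficients are $G^i$, with $2G^i=\frac12 g^{ih}\left(\frac{\partial^2F^2}{\partial y^h\partial x^k}y^k-\frac{\partial F^2}{\partial x^h}\right)$, so that geodesics satisfy $\ddot x^i+2G^i(x,\dot x)=0$. - $N^i_{\ j}=\partial G^i/\partial y^j$ is the canonical nonlinear connection, and $\frac{\delta}{\delta x^l}=\frac{\partial}{\partial x^l}-N^r_{\ l}\frac{\partial}{\partial y^r}$. - The Berwald connection has coefficients $G^i_{\ jk}=\frac{\partial^2G^i}{\partial y^j\partial y^k}$. Its horizontal covariant derivative is denoted by $|$; e.g. $C_{ijk|l}=\frac{\delta C_{ijk}}{\delta x^l}-G^h_{\ il}C_{hjk}-G^h_{\ jl}C_{ihk}-G^h_{\ kl}C_{ijh}$.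 - $C_{ijk}=\frac12\frac{\partial g_{ij}}{\partial y^k}$ is the Cartan tensor. An index $0$ denotes transvection by $y$, e.g. $C_{ijk|0}=C_{ijk|l}y^l$. $(M,F)$ is a Landsberg space if $C_{ijk|0}=0$; equivalently, if the Berwald connection is (horizontally) metrical, $g_{ij|k}=0$. $(M,F)$ is a Berwald space if the coefficients $G^i_{\ jk}$ are functions of $x$ alone; equivalently, if $C_{ijk|l}=0$; equivalently, if the $G^i$ are homogeneous polynomials of degree 2 in $y$. *)

(* Defs.v *)
From HB Require Import structures.
From mathcomp Require Import all_boot all_order all_algebra.
From mathcomp Require Import all_classical all_reals all_analysis.

Set Implicit Arguments.
Unset Strict Implicit.
Unset Printing Implicit Defensive.

Import Order.TTheory GRing.Theory Num.Theory.
Import numFieldNormedType.Exports.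

Local Open Scope classical_set_scope.
Local Open Scope ring_scope.

(* [U] is meant to be open, so that the values of [f] outside [U] play no role
   in the derivatives at the points of [U]. *)
Fixpoint Ck_on (R : realType) (n k : nat) (U : set 'rV[R]_n)
    (f : 'rV[R]_n -> R) : Prop :=
  (forall x, U x -> {for x, continuous f}) /\
  match k with
  | 0%N => True
  | k'.+1 => forall i : 'I_n,
      (forall x, U x -> derivable f x (delta_mx 0 i)) /\
      Ck_on k' U ('D_(delta_mx 0 i) f)
  end.

Definition smooth_on (R : realType) (n : nat) (U : set 'rV[R]_n)
    (f : 'rV[R]_n -> R) : Prop := forall k, Ck_on k U f.

Record chart (R : realType) (n : nat) (M : topologicalType) := Chart {
  chart_dom : set M;
  chart_map : M -> 'rV[R]_n;
  chart_inv : 'rV[R]_n -> M;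
  chart_dom_open : open chart_dom;
  chart_im_open : open (chart_map @` chart_dom);
  chart_mapK : forall p, chart_dom p -> chart_inv (chart_map p) = p;
  chart_map_cont : {within chart_dom, continuous chart_map};
  chart_inv_cont : {within chart_map @` chart_dom, continuous chart_inv} }.

Definition chart_im (R : realType) (n : nat) (M : topologicalType)
    (c : chart R n M) : set 'rV[R]_n := chart_map c @` chart_dom c.

Definition overlap (R : realType) (n : nat) (M : topologicalType)
    (c c' : chart R n M) : set 'rV[R]_n :=
  chart_map c @` (chart_dom c `&` chart_dom c').

Definition transition (R : realType) (n : nat) (M : topologicalType)
    (c c' : chart R n M) : 'rV[R]_n -> 'rV[R]_n :=
  chart_map c' \o chart_inv c.

(* The atlas need not be maximal. *)
Record smooth_manifold (R : realType) (n : nat) := SmoothManifold {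
  carrier :> topologicalType;
  atlas : set (chart R n carrier);
  manifold_hausdorff : hausdorff_space carrier;
  manifold_second_countable : @second_countable carrier;
  atlas_cover : forall p : carrier, exists2 c, atlas c & chart_dom c p;
  atlas_smooth : forall c c', atlas c -> atlas c' ->
    forall i : 'I_n,
      smooth_on (overlap c c') (fun x => transition c c' x 0 i) }.

Section Coordinates.
Context {R : realType} {n : nat}.

Definition pdx (i : 'I_n) (f : 'rV[R]_n -> 'rV[R]_n -> R)
    (x y : 'rV[R]_n) : R := 'D_(delta_mx 0 i) (fun x' => f x' y) x.

Definition pdy (i : 'I_n) (f : 'rV[R]_n -> 'rV[R]_n -> R)
    (x y : 'rV[R]_n) : R := 'D_(delta_mx 0 i) (fun y' => f x y') y.

Variable F : 'rV[R]_n -> 'rV[R]_n -> R.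

Definition sqF (x y : 'rV[R]_n) : R := F x y ^+ 2.

Definition metric (x y : 'rV[R]_n) : 'M[R]_n :=
  \matrix_(i, j) (2^-1 * pdy i (pdy j sqF) x y).

Definition inv_metric (x y : 'rV[R]_n) : 'M[R]_n := invmx (metric x y).

(* 2 G^i = 1/2 g^{ih} (d^2 F^2/dy^h dx^k y^k - dF^2/dx^h); the geodesics are
   the solutions of x'' + 2 G(x, x') = 0. *)
Definition spray (i : 'I_n) (x y : 'rV[R]_n) : R :=
  2^-1 * (2^-1 * \sum_h inv_metric x y i h *
    (\sum_k pdy h (pdx k sqF) x y * y 0 k - pdx h sqF x y)).

Definition nonlin_conn (i j : 'I_n) : 'rV[R]_n -> 'rV[R]_n -> R :=
  pdy j (spray i).

Definition berwald_conn (i j k : 'I_n) : 'rV[R]_n -> 'rV[R]_n -> R :=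
  pdy j (pdy k (spray i)).

Definition horizontal_deriv (l : 'I_n) (f : 'rV[R]_n -> 'rV[R]_n -> R)
    (x y : 'rV[R]_n) : R :=
  pdx l f x y - \sum_r nonlin_conn r l x y * pdy r f x y.

Definition cartan (i j k : 'I_n) (x y : 'rV[R]_n) : R :=
  2^-1 * pdy k (fun x' y' => metric x' y' i j) x y.

Definition cartan_hcov (i j k l : 'I_n) (x y : 'rV[R]_n) : R :=
  horizontal_deriv l (cartan i j k) x y
  - \sum_h berwald_conn h i l x y * cartan h j k x y
  - \sum_h berwald_conn h j l x y * cartan i h k x y
  - \sum_h berwald_conn h k l x y * cartan i j h x y.

End Coordinates.

(* A subset of TM and a function on it are given by their expressions in the
   induced charts of TM; the change of charts acts on TM by
   (x, y) |-> (t x, 'd t x y) where t is the transition map. *)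
Record finsler_space (R : realType) (n : nat) (M : smooth_manifold R n) :=
  FinslerSpace {
  fdom : chart R n M -> 'rV[R]_n -> set 'rV[R]_n;
  ffun : chart R n M -> 'rV[R]_n -> 'rV[R]_n -> R;
  fdom_slit : forall c, atlas c ->
    forall x y, fdom c x y -> chart_im c x /\ y != 0;
  fdom_open : forall c, atlas c ->
    open [set z : 'rV[R]_n * 'rV[R]_n | fdom c z.1 z.2];
  fdom_conic : forall c, atlas c ->
    forall x y (t : R), 0 < t -> fdom c x y -> fdom c x (t *: y);
  fdom_nonempty : forall c, atlas c ->
    forall x, chart_im c x -> exists y, fdom c x y;
  fdom_compat : forall c c', atlas c -> atlas c' ->
    forall x y, overlap c c' x ->
    fdom c x y <-> fdom c' (transition c c' x) ('d (transition c c') x y);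
  ffun_compat : forall c c', atlas c -> atlas c' ->
    forall x y, overlap c c' x -> fdom c x y ->
    ffun c' (transition c c' x) ('d (transition c c') x y) = ffun c x y;
  ffun_neq0 : forall c, atlas c -> forall x y, fdom c x y -> ffun c x y != 0;
  ffun_homogeneous : forall c, atlas c -> forall x y (t : R),
    0 < t -> fdom c x y -> ffun c x (t *: y) = t * ffun c x y;
  ffun_smooth : forall c, atlas c -> forall x, chart_im c x ->
    smooth_on (fdom c x) (ffun c x);
  ffun_nondegenerate : forall c, atlas c ->
    forall x y, fdom c x y -> metric (ffun c) x y \in unitmx }.

Definition landsberg (R : realType) (n : nat) (M : smooth_manifold R n)
    (F : finsler_space M) : Prop :=
  forall c, atlas c -> forall x y, fdom F c x y -> forall i j k : 'I_n,
  \sum_l cartan_hcov (ffun F c) i j k l x y * y 0 l = 0.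

Definition berwald (R : realType) (n : nat) (M : smooth_manifold R n)
    (F : finsler_space M) : Prop :=
  forall c, atlas c -> forall i j k : 'I_n, exists gamma : 'rV[R]_n -> R,
  forall x y, fdom F c x y -> berwald_conn (ffun F c) i j k x y = gamma x.

(* The real cube root, defined (and odd) on the whole real line. *)
Definition cbrt (R : realType) (t : R) : R := Num.sg t * `|t| `^ 3^-1.

(* The tensorial transformation law of the [a_ijk] is a consequence of
   [cubic_metric] together with their symmetry and [ffun_compat]. *)
Definition coef_symmetric (R : realType) (n : nat) (M : smooth_manifold R n)
    (a : chart R n M -> 'I_n -> 'I_n -> 'I_n -> 'rV[R]_n -> R) : Prop :=
  forall c, atlas c -> forall x, chart_im c x -> forall i j k : 'I_n,
  a c i j k x = a c j i k x /\ a c i j k x = a c i k j x.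

Definition coef_C1 (R : realType) (n : nat) (M : smooth_manifold R n)
    (a : chart R n M -> 'I_n -> 'I_n -> 'I_n -> 'rV[R]_n -> R) : Prop :=
  forall c, atlas c -> forall i j k : 'I_n, Ck_on 1 (chart_im c) (a c i j k).

Definition cubic_metric (R : realType) (n : nat) (M : smooth_manifold R n)
    (F : finsler_space M)
    (a : chart R n M -> 'I_n -> 'I_n -> 'I_n -> 'rV[R]_n -> R) : Prop :=
  forall c, atlas c -> forall x y, fdom F c x y ->
  ffun F c x y =
    cbrt (\sum_i \sum_j \sum_k a c i j k x * y 0 i * y 0 j * y 0 k).

(* Main.v *)
Require Import Defs.
From HB Require Import structures.
From mathcomp Require Import all_boot all_order all_algebra.
From mathcomp Require Import all_classical all_reals all_analysis.
From mathcomp Require Import ring lra.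

Set Implicit Arguments.
Unset Strict Implicit.
Unset Printing Implicit Defensive.

Import Order.TTheory GRing.Theory Num.Theory.
Import numFieldNormedType.Exports.

Local Open Scope classical_set_scope.
Local Open Scope ring_scope.

(* At a fixed [x] write subscripts for [y]-derivatives and [,l] for
   [x]-derivatives, and let [A = F^3] be the cubic form, [L = F^2]. The
   derivatives of the geodesic equations together with the Landsberg condition
   give [L_hi|j = 0]; contracting with [y] gives [L_|j = 0], hence [A_|j = 0]
   and [A_hi|j = 0]. As [A_hik] and [A_hik,j] do not depend on [y], two more
   derivatives and a contraction with [y^j] show that
   [A_hik,j = G^r_jh A_rik + G^r_ji A_rhk + G^r_jk A_rhi]: at every [y] the
   connection preserves the same constant cubic form. Let [D] be the difference
   of its values at [y0] and [y]. Contracting the resulting identity with [y]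
   gives [D^r_j0 A_r0 = 0] and then [D^r_00 A_rk = 0], so [D^r_00 = 0] because
   [A_rk] is nondegenerate. Thus [2 G^r (y) = G^r_jk (y0) y^j y^k] on the whole
   fibre, whether or not the domain of [F] over [x] is connected. *)

(** * Cube roots and partial derivatives *)

Section CubeRoot.
Context {R : realType}.

Lemma cbrt_cube (t : R) : cbrt t ^+ 3 = t.
Proof.
have p3 (u : R) : 0 <= u -> (u `^ 3^-1) ^+ 3 = u.
  by move=> u0; rewrite -powR_mulrn ?powR_ge0// -powRrM mulVf// powRr1.
rewrite /cbrt exprMn p3 //.
have [->|t0] := eqVneq t 0; first by rewrite normr0 mulr0.
by rewrite exprS sqr_sg t0 mulr1 -numEsg.
Qed.

(** On the line through [p] in direction [v], [f] keeps its nonzero sign $s$ near [p]. There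
    [cbrt f] is $s\,(sf)^{1/3}$, a composite with a power function on the positive reals. *)
Lemma derivable_cbrt_comp (V : normedModType R) (f : V -> R) (p v : V) :
  derivable f p v -> f p != 0 -> derivable (fun q => cbrt (f q)) p v.
Proof.
move=> df fp0; apply/derivable1P.
have /derivable1P df1 := df.
set g := fun h : R => f (h *: v + p); rewrite -/g in df1.
have g0 : g 0 = f p by rewrite /g scale0r add0r.
have cg : {for 0, continuous g}.
  exact/differentiable_continuous/derivable1_diffP.
have dcomp (s : R) : 0 < s * g 0 ->
    derivable (fun h => s * (s * g h) `^ 3^-1) 0 1.
  have dsg : derivable (fun h => s * g h) 0 1.
    exact: (@derivableM _ _ (cst s) g 0 1 (derivable_cst _ _ _) df1).
  move=> sg0; apply: (@derivableM _ _ (cst s) (fun h => (s * g h) `^ 3^-1)).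
    exact: derivable_cst.
  apply/derivable1_diffP.
  rewrite -[X in differentiable X _]/((@powR R ^~ 3^-1) \o (fun h => s * g h)).
  apply: differentiable_comp.
    by apply/derivable1_diffP.
  apply/derivable1_diffP/derivable_powR.
  by rewrite in_itv/= andbT.
rewrite -g0 in fp0; have [gneg|gpos] := orP (lt_total fp0).
- apply: near_eq_derivable (dcomp (-1) _); last by rewrite mulN1r oppr_gt0.
  have : \forall h \near (0 : R), g h < 0 by exact: (cvgr_lt (g 0) cg).
  apply: filterS => h gh; rewrite /cbrt -/(g h).
  by rewrite ltr0_sg // ltr0_norm // !mulN1r.
- apply: near_eq_derivable (dcomp 1 _); last by rewrite mul1r.
  have : \forall h \near (0 : R), 0 < g h by exact: (cvgr_gt (g 0) cg).
  apply: filterS => h gh; rewrite /cbrt -/(g h).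
  by rewrite gtr0_sg // gtr0_norm // !mul1r.
Qed.

End CubeRoot.

(* Locked, so that unification never unfolds a derivative to a limit. *)
HB.lock Definition pd (R : realType) (n : nat) (s : bool) (i : 'I_n)
    (f : 'rV[R]_n -> 'rV[R]_n -> R) (x y : 'rV[R]_n) : R :=
  if s then pdx i f x y else pdy i f x y.

HB.lock Definition pdable (R : realType) (n : nat) (D : 'rV[R]_n -> set 'rV[R]_n)
    (s : bool) (i : 'I_n) (f : 'rV[R]_n -> 'rV[R]_n -> R) : Prop :=
  forall x y, D x y ->
  if s then derivable (fun x' => f x' y) x (delta_mx 0 i)
  else derivable (fun y' => f x y') y (delta_mx 0 i).

(** * Functions built from coefficients and coordinates, and their derivatives *)

Section Tame.
Context {R : realType} {n : nat}.
Variable D : 'rV[R]_n -> set 'rV[R]_n.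
Hypothesis D_open : open [set z : 'rV[R]_n * 'rV[R]_n | D z.1 z.2].
Local Notation pdable := (pdable D).
Implicit Types f g : 'rV[R]_n -> 'rV[R]_n -> R.

Lemma D_near_fst x y : D x y -> \forall x' \near x, D x' y.
Proof.
move=> Dxy.
have : nbhs (x, y) [set z | D z.1 z.2] by exact: open_nbhs_nbhs.
move=> [[A B]] /= [nA nB] sub; apply: filterS nA => x' Ax'.
by apply: (sub (x', y)); split => //=; exact: nbhs_singleton.
Qed.

Lemma D_near_snd x y : D x y -> \forall y' \near y, D x y'.
Proof.
move=> Dxy.
have : nbhs (x, y) [set z | D z.1 z.2] by exact: open_nbhs_nbhs.
move=> [[A B]] /= [nA nB] sub; apply: filterS nB => y' By'.
by apply: (sub (x, y')); split => //=; exact: nbhs_singleton.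
Qed.

Lemma pd_ext (s : bool) i f g x y : (forall x y, D x y -> f x y = g x y) -> D x y ->
  pd s i f x y = pd s i g x y.
Proof.
move=> fg Dxy; rewrite pd.unlock; case: s; apply: near_eq_derive.
- by apply: filterS (D_near_fst Dxy) => x' /fg.
- by apply: filterS (D_near_snd Dxy) => y' /fg.
Qed.

Lemma pdable_ext s i f g : (forall x y, D x y -> f x y = g x y) ->
  pdable s i f -> pdable s i g.
Proof.
rewrite pdable.unlock => fg df x y Dxy; have := df x y Dxy.
case: s {df}; apply: near_eq_derivable.
- by apply: filterS (D_near_fst Dxy) => x' /fg.
- by apply: filterS (D_near_snd Dxy) => y' /fg.
Qed.

Lemma pdableD s i f g : pdable s i f -> pdable s i g ->
  pdable s i (fun x y => f x y + g x y).
Proof.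
rewrite pdable.unlock => df dg x y Dxy; move: (df x y Dxy) (dg x y Dxy); case: s {df dg}.
- exact: (@derivableD _ _ _ (f^~ y) (g^~ y)).
- exact: (@derivableD _ _ _ (f x) (g x)).
Qed.

Lemma pdableM s i f g : pdable s i f -> pdable s i g ->
  pdable s i (fun x y => f x y * g x y).
Proof.
rewrite pdable.unlock => df dg x y Dxy; move: (df x y Dxy) (dg x y Dxy); case: s {df dg}.
- exact: (@derivableM _ _ (f^~ y) (g^~ y)).
- exact: (@derivableM _ _ (f x) (g x)).
Qed.

Lemma pdableV s i f : (forall x y, D x y -> f x y != 0) -> pdable s i f ->
  pdable s i (fun x y => (f x y)^-1).
Proof.
rewrite pdable.unlock => f0 df x y Dxy; move: (f0 x y Dxy) (df x y Dxy); case: s {df}.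
- exact: (@derivableV _ _ (f^~ y)).
- exact: (@derivableV _ _ (f x)).
Qed.

Lemma pdable_cbrt s i f : (forall x y, D x y -> f x y != 0) -> pdable s i f ->
  pdable s i (fun x y => cbrt (f x y)).
Proof.
rewrite pdable.unlock => f0 df x y Dxy; move: (df x y Dxy) (f0 x y Dxy); case: s {df}.
- exact: (@derivable_cbrt_comp _ _ (f^~ y)).
- exact: (@derivable_cbrt_comp _ _ (f x)).
Qed.

Lemma pdD s i f g x y : pdable s i f -> pdable s i g -> D x y ->
  pd s i (fun x y => f x y + g x y) x y = pd s i f x y + pd s i g x y.
Proof.
rewrite pd.unlock pdable.unlock => df dg Dxy; move: (df x y Dxy) (dg x y Dxy); case: s {df dg}.
- exact: (@deriveD _ _ _ (f^~ y) (g^~ y)).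
- exact: (@deriveD _ _ _ (f x) (g x)).
Qed.

Lemma pdM s i f g x y : pdable s i f -> pdable s i g -> D x y ->
  pd s i (fun x y => f x y * g x y) x y =
  f x y * pd s i g x y + pd s i f x y * g x y.
Proof.
rewrite pd.unlock pdable.unlock => df dg Dxy; rewrite [X in _ + X]mulrC.
move: (df x y Dxy) (dg x y Dxy); case: s {df dg}.
- exact: (@deriveM _ _ (f^~ y) (g^~ y)).
- exact: (@deriveM _ _ (f x) (g x)).
Qed.

Lemma pdV s i f x y : (forall x y, D x y -> f x y != 0) -> pdable s i f ->
  D x y ->
  pd s i (fun x y => (f x y)^-1) x y =
  - (f x y)^-1 * (f x y)^-1 * pd s i f x y.
Proof.
rewrite pd.unlock pdable.unlock => f0 df Dxy; rewrite mulNr -invfM -expr2.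
move: (f0 x y Dxy) (df x y Dxy); case: s {df}.
- exact: (@deriveV _ _ (f^~ y)).
- exact: (@deriveV _ _ (f x)).
Qed.

Lemma pd_fst s i (c : 'rV[R]_n -> R) x y :
  pd s i (fun x _ => c x) x y = if s then 'D_(delta_mx 0 i) c x else 0.
Proof. by rewrite pd.unlock; case: s => //; exact: derive_cst. Qed.

Lemma is_derive_coord (i j : 'I_n) (y : 'rV[R]_n) :
  is_derive y (delta_mx 0 j) (fun y' : 'rV[R]_n => y' 0 i) (i == j)%:R.
Proof.
have dl := @differentiable_coord R 1 n y 0 i.
split; first exact: diff_derivable.
have @f : {linear 'rV[R]_n -> R}.
  by exists (fun N : 'rV[R]_n => N 0 i); do 2![eexists]; do ?[constructor];
     rewrite ?mxE// => ? *; rewrite ?mxE//; move=> ?; rewrite !mxE.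
rewrite deriveE // (_ : (fun _ => _) = f) // diff_lin; last first.
  exact: coord_continuous.
by rewrite /= mxE eqxx.
Qed.

Lemma pd_coord s (i j : 'I_n) (x y : 'rV[R]_n) :
  pd s j (fun _ y => y 0 i) x y = (~~ s && (i == j))%:R.
Proof.
rewrite pd.unlock; case: s => /=; first exact: derive_cst.
exact: (@derive_val _ _ _ _ _ _ _ (is_derive_coord i j y)).
Qed.

Lemma pdable_fst (s : bool) i (c : 'rV[R]_n -> R) :
  (s -> forall x y, D x y -> derivable c x (delta_mx 0 i)) ->
  pdable s i (fun x _ => c x).
Proof.
rewrite pdable.unlock => dc x y Dxy; case: s dc => [dc|_]; last exact: derivable_cst.
exact: (dc isT x y Dxy).
Qed.

Lemma pdable_coord s i j : pdable s j (fun _ y => y 0 i).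
Proof.
rewrite pdable.unlock => x y _; case: s; first exact: derivable_cst.
by have [] := is_derive_coord i j y.
Qed.

(* The flag [b] tells whether [f] can also be differentiated (once) in [x]. *)
Inductive tame (b : bool) : ('rV[R]_n -> 'rV[R]_n -> R) -> Prop :=
| tame_fst c : (b -> forall x y, D x y -> forall i : 'I_n,
    derivable c x (delta_mx 0 i)) -> tame b (fun x _ => c x)
| tame_coord i : tame b (fun _ y => y 0 i)
| tameD f g : tame b f -> tame b g -> tame b (fun x y => f x y + g x y)
| tameM f g : tame b f -> tame b g -> tame b (fun x y => f x y * g x y)
| tameV f : (forall x y, D x y -> f x y != 0) -> tame b f ->
    tame b (fun x y => (f x y)^-1)
| tame_cbrt f : (forall x y, D x y -> f x y != 0) -> tame b f ->
    tame b (fun x y => cbrt (f x y))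
| tame_ext f g : (forall x y, D x y -> f x y = g x y) -> tame b f -> tame b g.

Lemma tameW b f : tame b f -> tame false f.
Proof. by elim => *; by [apply: tame_fst|apply: tame_coord|apply: tameD|
 apply: tameM|apply: tameV|apply: tame_cbrt|apply: tame_ext; eassumption]. Qed.

Lemma tame_cst b r : tame b (fun _ _ => r).
Proof. by apply: (@tame_fst b (fun _ => r)) => *; exact: derivable_cst. Qed.

Lemma tame_pdable (b s : bool) i f : (s -> b) -> tame b f -> pdable s i f.
Proof.
move=> sb; elim => {f}.
- by move=> c dc; apply: pdable_fst => /sb /dc dc' x y Dxy; exact: (dc' x y Dxy).
- by move=> j; exact: pdable_coord.
- by move=> f g _ df _ dg; exact: pdableD.
- by move=> f g _ df _ dg; exact: pdableM.
- by move=> f f0 _ df; exact: pdableV.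
- by move=> f f0 _ df; exact: pdable_cbrt.
- by move=> f g fg _; exact: pdable_ext.
Qed.

(** Derivability of $g=\sqrt[3]{f}$ being known, the formula follows by applying the product rule to
    $f=g\cdot(g\cdot g)$ and solving for the derivative of $g$. *)
Lemma pd_cbrt s i f x y : (forall x y, D x y -> f x y != 0) -> pdable s i f ->
  D x y ->
  pd s i (fun x y => cbrt (f x y)) x y =
  3^-1 * (cbrt (f x y) * cbrt (f x y))^-1 * pd s i f x y.
Proof.
move=> f0 df Dxy; set g := fun x y => cbrt (f x y).
have dg : pdable s i g by exact: pdable_cbrt.
have g0 : g x y != 0.
  by apply: contra_neq (f0 x y Dxy) => g0; rewrite -[LHS]cbrt_cube -/(g x y) g0 expr0n.
have -> : pd s i f x y = pd s i (fun x y => g x y * (g x y * g x y)) x y.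
  by apply: pd_ext => // x' y' _; rewrite -!expr2 -exprS cbrt_cube.
have dgg := pdableM dg dg; rewrite -/g -/(g x y); clearbody g.
by rewrite !pdM //; field.
Qed.

(** A [y]-derivative keeps the flag. An [x]-derivative uses it up, since the coefficients can be
    differentiated only once in [x]. *)
Lemma tame_pd (b s : bool) i f : (s -> b) -> tame b f -> tame (b && ~~ s) (pd s i f).
Proof.
move=> sb; have W h : tame b h -> tame (b && ~~ s) h.
  by case: s sb; rewrite ?andbT // andbF => _; exact: tameW.
elim => {f}.
- move=> c dc; case: s sb W => sb W.
    rewrite andbF; apply: tame_ext (@tame_fst false ('D_(delta_mx 0 i) c) _) => //.
    by move=> x y _; rewrite pd_fst.
  apply: tame_ext (tame_cst _ 0) => x y _.
  by rewrite pd_fst.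
- move=> j; apply: tame_ext (tame_cst _ (~~ s && (j == i))%:R) => x y _.
  by rewrite pd_coord.
- move=> f g tf df tg dg; apply: tame_ext (tameD df dg) => x y Dxy.
  by rewrite pdD //; apply: tame_pdable sb _.
- move=> f g tf df tg dg.
  apply: tame_ext (tameD (tameM (W _ tf) dg) (tameM df (W _ tg))) => x y Dxy.
  by rewrite pdM //; apply: tame_pdable sb _.
- move=> f f0 tf df; have tv := W _ (tameV f0 tf).
  apply: tame_ext (tameM (tameM (tameM (tame_cst _ (-1)) tv) tv) df) => x y Dxy.
  by rewrite pdV //; [rewrite mulN1r|exact: tame_pdable sb _].
- move=> f f0 tf df; have tv := W _ (tame_cbrt f0 tf).
  have v0 x y : D x y -> cbrt (f x y) * cbrt (f x y) != 0.
    move=> Dxy; apply: contra_neq (f0 x y Dxy) => g0.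
    by rewrite -[LHS]cbrt_cube exprS expr2 g0 mulr0.
  apply: tame_ext (tameM (tameM (tame_cst _ 3^-1) (tameV v0 (tameM tv tv))) df).
  by move=> x y Dxy; rewrite pd_cbrt //; exact: tame_pdable sb _.
- move=> f g fg tf df; apply: tame_ext df => x y Dxy; exact: pd_ext.
Qed.

(** By induction on the construction of [f]: for each constructor the two orders of differentiation
    expand to the same expression. The condition on [s] and [t] excludes two [x]-derivatives, beyond
    the $C^1$ coefficients. *)
Lemma pdC (b s t : bool) i j f x y : (s -> b) -> (t -> b) -> ~~ (s && t) ->
  tame b f -> D x y -> pd s i (pd t j f) x y = pd t j (pd s i f) x y.
Proof.
move=> sb tb st tf Dxy.
(* At least one of the two derivatives is in [y], and by the symmetry of the claim it may be taken
   as the outer one on the left. *)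
wlog s0 : s t i j sb tb st / s = false.
  move=> H; have [ss|ss] := boolP s; last by apply: H => //; exact: negbTE.
  have t0 : t = false by move: st; rewrite ss /= => /negbTE.
  by apply/esym/H; rewrite ?t0 // => _; exact: sb.
move: sb st; rewrite {}s0 => _ _.
have sb : false -> b by [].
have dd k g : tame b g -> pdable false k g by exact: tame_pdable.
have ddt k g : tame b g -> pdable t k g by exact: tame_pdable.
have ds k g : tame b g -> pdable t k (pd false i g).
  by move=> tg; apply: (@tame_pdable b) => //; have := tame_pd i sb tg; rewrite andbT.
have dt k g : tame b g -> pdable false k (pd t j g).
  by move=> tg; apply: (@tame_pdable (b && ~~ t)) => //; exact: tame_pd.
have ext u k g h : (forall x y, D x y -> g x y = h x y) -> pd u k g x y = pd u k h x y.
  by move=> gh; exact: pd_ext.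
elim: tf => {f}.
- move=> c dc.
  rewrite (ext _ _ _ (fun x _ => if t then 'D_(delta_mx 0 j) c x else 0)); last first.
    by move=> x' y' _; rewrite pd_fst.
  rewrite (ext t _ _ (fun x _ => 0)); last by move=> x' y' _; rewrite pd_fst.
  by rewrite !pd_fst; case: (t) => //; rewrite derive_cst.
- move=> k; rewrite (ext false _ _ (fun x _ => (~~ t && (k == j))%:R)); last first.
    by move=> x' y' _; rewrite pd_coord.
  rewrite (ext t _ _ (fun x _ => (k == i)%:R)); last by move=> x' y' _; rewrite pd_coord.
  by rewrite !pd_fst; case: (t) => //; rewrite derive_cst.
- move=> f g tf IHf tg IHg.
  rewrite (ext false _ _ (fun x y => pd t j f x y + pd t j g x y)); last first.
    by move=> x' y' Dxy'; rewrite pdD //; auto.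
  rewrite (ext t _ _ (fun x y => pd false i f x y + pd false i g x y)); last first.
    by move=> x' y' Dxy'; rewrite pdD //; auto.
  by rewrite !pdD ?IHf ?IHg //; auto.
- move=> f g tf IHf tg IHg.
  rewrite (ext false _ _ (fun x y =>
      f x y * pd t j g x y + pd t j f x y * g x y)); last first.
    by move=> x' y' Dxy'; rewrite pdM //; auto.
  rewrite (ext t _ _ (fun x y =>
      f x y * pd false i g x y + pd false i f x y * g x y)); last first.
    by move=> x' y' Dxy'; rewrite pdM //; auto.
  rewrite (pdD (pdableM (dd _ _ tf) (dt _ _ tg)) (pdableM (dt _ _ tf) (dd _ _ tg)) Dxy).
  rewrite (pdD (pdableM (ddt _ _ tf) (ds _ _ tg)) (pdableM (ds _ _ tf) (ddt _ _ tg)) Dxy).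
  rewrite (pdM (dd _ _ tf) (dt _ _ tg) Dxy) (pdM (dt _ _ tf) (dd _ _ tg) Dxy).
  rewrite (pdM (ddt _ _ tf) (ds _ _ tg) Dxy) (pdM (ds _ _ tf) (ddt _ _ tg) Dxy).
  by rewrite IHf IHg; ring.
- move=> f f0 tf IHf; set g := fun x y => (f x y)^-1.
  have tg : tame b g := tameV f0 tf.
  have gV u k x' y' : D x' y' -> pdable u k f ->
      pd u k g x' y' = - g x' y' * g x' y' * pd u k f x' y'.
    by move=> Dxy' duf; exact: pdV.
  have tgg := tameM (tame_cst _ (-1)) (tameM tg tg).
  rewrite (ext false _ _ (fun x y => -1 * (g x y * g x y) * pd t j f x y)); last first.
    by move=> x' y' Dxy'; rewrite (gV _ _ _ _ Dxy' (ddt _ _ tf)) mulN1r !mulNr.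
  rewrite (ext t _ _ (fun x y => -1 * (g x y * g x y) * pd false i f x y)); last first.
    by move=> x' y' Dxy'; rewrite (gV _ _ _ _ Dxy' (dd _ _ tf)) mulN1r !mulNr.
  rewrite (pdM (dd _ _ tgg) (dt _ _ tf) Dxy) (pdM (ddt _ _ tgg) (ds _ _ tf) Dxy) IHf.
  (* Derivative of the factor $-f^{-2}$. Multiplied by the other first derivative of [f], it becomes
     symmetric in the two directions. *)
  have E u k : pdable u k f -> pdable u k g ->
      pd u k (fun x y => -1 * (g x y * g x y)) x y =
      2 * g x y * g x y * g x y * pd u k f x y.
    move=> duf dug; have dc : pdable u k (fun _ _ => -1).
      by apply: pdable_fst => *; exact: derivable_cst.
    rewrite (pdM dc (pdableM dug dug) Dxy) (pdM dug dug Dxy) (gV _ _ _ _ Dxy duf).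
    by rewrite (pd_fst u k (fun=> -1)) derive_cst if_same; ring.
  rewrite (E _ _ (dd _ _ tf) (dd _ _ tg)) (E _ _ (ddt _ _ tf) (ddt _ _ tg)).
  by ring.
- move=> f f0 tf IHf; set g := fun x y => cbrt (f x y).
  have tg : tame b g := tame_cbrt f0 tf.
  have g0 x' y' : D x' y' -> g x' y' != 0.
    move=> Dxy'; apply: contra_neq (f0 x' y' Dxy') => g0.
    by rewrite -[LHS]cbrt_cube -/(g x' y') g0 expr0n.
  have gg0 x' y' : D x' y' -> g x' y' * g x' y' != 0.
    by move=> Dxy'; rewrite mulf_neq0 ?g0.
  have gD u k x' y' : D x' y' -> pdable u k f ->
      pd u k g x' y' = 3^-1 * (g x' y' * g x' y')^-1 * pd u k f x' y'.
    by move=> Dxy' duf; exact: pd_cbrt.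
  have tgg := tameM (tame_cst _ 3^-1) (tameV gg0 (tameM tg tg)).
  rewrite (ext false _ _ (fun x y => 3^-1 * (g x y * g x y)^-1 * pd t j f x y)); last first.
    by move=> x' y' Dxy'; exact: (gD _ _ _ _ Dxy' (ddt _ _ tf)).
  rewrite (ext t _ _ (fun x y => 3^-1 * (g x y * g x y)^-1 * pd false i f x y)); last first.
    by move=> x' y' Dxy'; exact: (gD _ _ _ _ Dxy' (dd _ _ tf)).
  rewrite (pdM (dd _ _ tgg) (dt _ _ tf) Dxy) (pdM (ddt _ _ tgg) (ds _ _ tf) Dxy) IHf.
  (* Derivative of the factor $\frac13 f^{-2/3}$: the constant is $\frac13\cdot(-\frac23)$, and
     $f^{-5/3}=g^{-5}$. *)
  have E u k : pdable u k f -> pdable u k g ->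
      pd u k (fun x y => 3^-1 * (g x y * g x y)^-1) x y =
      - (2 / 9) * (g x y)^-1 ^+ 5 * pd u k f x y.
    move=> duf dug; have dc : pdable u k (fun _ _ => 3^-1).
      by apply: pdable_fst => *; exact: derivable_cst.
    have dgg := pdableM dug dug.
    rewrite (pdM dc (pdableV gg0 dgg) Dxy) (pdV gg0 dgg Dxy) (pdM dug dug Dxy).
    rewrite (gD _ _ _ _ Dxy duf) (pd_fst u k (fun=> 3^-1)) derive_cst if_same.
    by field; exact: g0.
  rewrite (E _ _ (dd _ _ tf) (dd _ _ tg)) (E _ _ (ddt _ _ tf) (ddt _ _ tg)).
  by ring.
- move=> f g fg tf IHf.
  rewrite (ext false _ _ (pd t j f)); last first.
    by move=> x' y' Dxy'; apply: pd_ext => // *; rewrite fg.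
  rewrite (ext t _ _ (pd false i f)) //.
  by move=> x' y' Dxy'; apply: pd_ext => // *; rewrite fg.
Qed.

End Tame.

(** * Calculus along the fibres *)

Section TameCalculus.
Context {R : realType} {n : nat}.
Variable D : 'rV[R]_n -> set 'rV[R]_n.
Hypothesis D_open : open [set z : 'rV[R]_n * 'rV[R]_n | D z.1 z.2].
Local Notation fn := ('rV[R]_n -> 'rV[R]_n -> R).
Local Notation dx := (@pd R n true).
Local Notation dy := (@pd R n false).
Implicit Types (f g : fn) (u v : 'I_n -> fn).

(** In contrast with [pd_ext], agreement on the single fibre over [x] is enough. This allows
    differentiating in [y] identities that involve a second vector [y0] over the same [x]. *)
Lemma dy_ext i f g x y : (forall y, D x y -> f x y = g x y) -> D x y ->
  dy i f x y = dy i g x y.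
Proof.
move=> fg Dxy; rewrite pd.unlock; apply: near_eq_derive.
by apply: filterS (D_near_snd D_open Dxy) => y' /fg.
Qed.

Lemma dx_ext i f g x y : (forall x y, D x y -> f x y = g x y) -> D x y ->
  dx i f x y = dx i g x y.
Proof. exact: (@pd_ext _ _ _ D_open true). Qed.

Lemma tame_dy b i f : tame D b f -> tame D b (dy i f).
Proof.
have b0 : false -> b by [].
by move=> /(@tame_pd _ _ _ D_open _ _ i _ b0); rewrite andbT.
Qed.

Lemma tame_dx i f : tame D true f -> tame D false (dx i f).
Proof. by move=> /(@tame_pd _ _ _ D_open true true i _ id). Qed.

Lemma tameN b f : tame D b f -> tame D b (fun x y => - f x y).
Proof.
move=> tf; apply: tame_ext (tameM (tame_cst _ _ (-1)) tf) => x y _.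
by rewrite mulN1r.
Qed.

Lemma tameB b f g : tame D b f -> tame D b g -> tame D b (fun x y => f x y - g x y).
Proof. by move=> tf /tameN; exact: tameD. Qed.

Lemma tameZ b r f : tame D b f -> tame D b (fun x y => r * f x y).
Proof. by move=> tf; apply: (tameM (tame_cst _ _ r)). Qed.

Lemma tame_sum b (I : Type) (s : seq I) (P : pred I) (w : I -> fn) :
  (forall i, tame D b (w i)) -> tame D b (fun x y => \sum_(i <- s | P i) w i x y).
Proof.
move=> tw; elim: s => [|i s IH].
  by apply: tame_ext (tame_cst _ _ 0) => x y _; rewrite big_nil.
case Pi : (P i).
  by apply: tame_ext (tameD (tw i) IH) => x y _; rewrite big_cons Pi.
by apply: tame_ext IH => x y _; rewrite big_cons Pi.
Qed.

Lemma tame_prod b (I : Type) (s : seq I) (P : pred I) (w : I -> fn) :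
  (forall i, tame D b (w i)) -> tame D b (fun x y => \prod_(i <- s | P i) w i x y).
Proof.
move=> tw; elim: s => [|i s IH].
  by apply: tame_ext (tame_cst _ _ 1) => x y _; rewrite big_nil.
case Pi : (P i).
  by apply: tame_ext (tameM (tw i) IH) => x y _; rewrite big_cons Pi.
by apply: tame_ext IH => x y _; rewrite big_cons Pi.
Qed.

(** By the Leibniz formula the determinant is a polynomial in the entries. *)
Lemma tame_det b m (w : 'I_m -> 'I_m -> fn) :
  (forall i j, tame D b (w i j)) ->
  tame D b (fun x y => \det (\matrix_(i, j) w i j x y)).
Proof.
move=> tw; rewrite /determinant; apply: tame_sum => s.
apply: tameM; first exact: tame_cst.
apply: tame_prod => i; refine (tame_ext _ (tw i (perm.fun_of_perm s i))) => x y _.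
by rewrite mxE.
Qed.

(** By the cofactor formula each entry of the inverse is a minor, up to sign, over the nonvanishing
    determinant. *)
Lemma tame_invmx b m (w : 'I_m -> 'I_m -> fn) :
  (forall i j, tame D b (w i j)) ->
  (forall x y, D x y -> \matrix_(i, j) w i j x y \in unitmx) ->
  forall i j, tame D b (fun x y => invmx (\matrix_(i, j) w i j x y) i j).
Proof.
move=> tw wu i j.
have td := tame_det tw.
have d0 x y : D x y -> \det (\matrix_(i, j) w i j x y) != 0.
  by move=> /wu; rewrite unitmxE unitfE.
have ta : tame D b (fun x y => cofactor (\matrix_(i, j) w i j x y) j i).
  apply: tameM; first exact: tame_cst.
  have ta : forall k l, tame D b (w (lift j k) (lift i l)) by [].
  apply: tame_ext (tame_det ta) => x y _.
  by congr (\det _); apply/matrixP => k l; rewrite !mxE.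
apply: tame_ext (tameM (tameV d0 td) ta) => x y Dxy.
by rewrite /invmx wu // !mxE.
Qed.

Lemma dy_able i f : tame D false f -> pdable D false i f.
Proof. exact: tame_pdable. Qed.

Lemma dx_able i f : tame D true f -> pdable D true i f.
Proof. exact: tame_pdable. Qed.

Lemma dyD i f g x y : tame D false f -> tame D false g -> D x y ->
  dy i (fun x y => f x y + g x y) x y = dy i f x y + dy i g x y.
Proof. by move=> /(dy_able i) tf /(dy_able i) tg; exact: pdD. Qed.

Lemma dyM i f g x y : tame D false f -> tame D false g -> D x y ->
  dy i (fun x y => f x y * g x y) x y =
  dy i f x y * g x y + f x y * dy i g x y.
Proof. by move=> /(dy_able i) tf /(dy_able i) tg Dxy; rewrite (pdM tf tg Dxy) addrC. Qed.

Lemma dy_fst i (c : 'rV[R]_n -> R) x y : dy i (fun x _ => c x) x y = 0.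
Proof. by rewrite pd_fst. Qed.

Lemma dy_coord i j x y : dy j (fun _ y => y 0 i) x y = (i == j)%:R :> R.
Proof. by rewrite pd_coord. Qed.

Lemma dyZ i r f x y : tame D false f -> D x y ->
  dy i (fun x y => r * f x y) x y = r * dy i f x y.
Proof.
move=> tf Dxy; rewrite (@dyM i (fun _ _ => r)) //; last exact: tame_cst.
by rewrite (dy_fst i (fun=> r)) mul0r add0r.
Qed.

Lemma dyN i f x y : tame D false f -> D x y ->
  dy i (fun x y => - f x y) x y = - dy i f x y.
Proof.
move=> tf Dxy; rewrite -mulN1r -dyZ //.
by apply: dy_ext => // y' _; rewrite mulN1r.
Qed.

Lemma dyB i f g x y : tame D false f -> tame D false g -> D x y ->
  dy i (fun x y => f x y - g x y) x y = dy i f x y - dy i g x y.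
Proof. by move=> tf tg Dxy; rewrite dyD ?dyN //; exact: tameN. Qed.

Lemma dxZ i r f x y : tame D true f -> D x y ->
  dx i (fun x y => r * f x y) x y = r * dx i f x y.
Proof.
move=> tf Dxy; rewrite (pdM (dx_able i (tame_cst _ _ r)) (dx_able i tf) Dxy).
by rewrite (pd_fst true i (fun=> r)) derive_cst mul0r addr0.
Qed.

Lemma dy_sum (I : Type) (s : seq I) (w : I -> fn) i x y :
  (forall i, tame D false (w i)) -> D x y ->
  dy i (fun x y => \sum_(k <- s) w k x y) x y = \sum_(k <- s) dy i (w k) x y.
Proof.
move=> tw Dxy; elim: s => [|k s IH].
  rewrite big_nil -[RHS](dy_fst i (fun=> 0) x y).
  by apply: dy_ext => // y' _; rewrite big_nil.
rewrite big_cons -IH -dyD //; last exact: tame_sum.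
by apply: dy_ext => // y' _; rewrite big_cons.
Qed.

Lemma dyC i j f x y : tame D false f -> D x y ->
  dy i (dy j f) x y = dy j (dy i f) x y.
Proof. by move=> tf Dxy; apply: (@pdC _ _ _ D_open false false false). Qed.

Lemma dxyC i j f x y : tame D true f -> D x y ->
  dx i (dy j f) x y = dy j (dx i f) x y.
Proof. by move=> tf Dxy; apply: (@pdC _ _ _ D_open true true false). Qed.

(** * Index calculus: contractions and fibre derivatives of indexed families *)

Definition dot u v : fn := fun x y => \sum_r u r x y * v r x y.

Definition grad f : 'I_n -> fn := fun r => dy r f.

(** The index of the original family stays last: [dv h (grad L) r] is $L_{rh}$, and
    [dv h (dv j G) r] is $G^r_{jh}$. *)
Definition dv j u : 'I_n -> fn := fun r => dy j (u r).

Definition ycoord : 'I_n -> fn := fun r _ y => y 0 r.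

Definition vtame u := forall r, tame D false (u r).

Lemma vtame_dv j u : vtame u -> vtame (dv j u).
Proof. by move=> tu r; apply: tame_dy. Qed.

Lemma vtame_grad f : tame D false f -> vtame (grad f).
Proof. by move=> tf r; apply: tame_dy. Qed.

Lemma vtame_coord : vtame ycoord.
Proof. by move=> r; apply: tame_coord. Qed.

Lemma tame_dot u v : vtame u -> vtame v -> tame D false (dot u v).
Proof. by move=> tu tv; apply: tame_sum => r; apply: tameM. Qed.

Lemma dy_dot j u v x y : vtame u -> vtame v -> D x y ->
  dy j (dot u v) x y = dot (dv j u) v x y + dot u (dv j v) x y.
Proof.
move=> tu tv Dxy; rewrite dy_sum //; last by move=> r; apply: tameM.
by rewrite -big_split; apply: eq_bigr => r _; rewrite dyM.
Qed.

Lemma dot_ext u v u' v' x y : (forall r, u r x y = u' r x y) ->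
  (forall r, v r x y = v' r x y) -> dot u v x y = dot u' v' x y.
Proof. by move=> uu vv; apply: eq_bigr => r _; rewrite uu vv. Qed.

Lemma dot_dv_coord j u x y : dot u (dv j ycoord) x y = u j x y.
Proof.
rewrite /dot (bigD1 j) //= /dv dy_coord eqxx mulr1 big1 ?addr0 // => r rj.
by rewrite dy_coord (negbTE rj) mulr0.
Qed.

Lemma dvC i j u r x y : vtame u -> D x y ->
  dv i (dv j u) r x y = dv j (dv i u) r x y.
Proof. by move=> tu Dxy; exact: dyC. Qed.

Lemma dvC' i j k u r x y : vtame u -> D x y ->
  dv k (dv i (dv j u)) r x y = dv k (dv j (dv i u)) r x y.
Proof. by move=> tu Dxy; apply: dy_ext => // y' Dxy'; exact: dvC. Qed.

(** * Homogeneity in [y], expressed by Euler's identity *)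

Definition euler (d : R) f := forall x y, D x y ->
  dot (grad f) ycoord x y = d * f x y.

Lemma euler_ext d f g : (forall x y, D x y -> f x y = g x y) -> euler d f -> euler d g.
Proof.
move=> fg ef x y Dxy; rewrite -fg // -ef //; apply: dot_ext => // r.
by apply/esym; apply: dy_ext => // y' /fg.
Qed.

Lemma euler_coord r : euler 1 (ycoord r).
Proof.
move=> x y Dxy; rewrite mul1r /dot (bigD1 r) //= /grad dy_coord eqxx mul1r.
by rewrite big1 ?addr0 // => k rk; rewrite dy_coord eq_sym (negbTE rk) mul0r.
Qed.

Lemma euler_fst (c : 'rV[R]_n -> R) : euler 0 (fun x _ => c x).
Proof.
by move=> x y Dxy; rewrite mul0r; apply: big1 => r _; rewrite /grad dy_fst mul0r.
Qed.

Lemma eulerD d f g : tame D false f -> tame D false g ->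
  euler d f -> euler d g -> euler d (fun x y => f x y + g x y).
Proof.
move=> tf tg ef eg x y Dxy; rewrite mulrDr -ef // -eg // -big_split.
by apply: eq_bigr => r _; rewrite /grad dyD // mulrDl.
Qed.

Lemma eulerM d e f g : tame D false f -> tame D false g ->
  euler d f -> euler e g -> euler (d + e) (fun x y => f x y * g x y).
Proof.
move=> tf tg ef eg x y Dxy.
have -> : (d + e) * (f x y * g x y) = d * f x y * g x y + f x y * (e * g x y) by ring.
rewrite -ef // -eg // mulr_suml mulr_sumr -big_split.
by apply: eq_bigr => r _; rewrite /grad dyM //=; ring.
Qed.

Lemma eulerN d f : tame D false f -> euler d f -> euler d (fun x y => - f x y).
Proof.
move=> tf ef x y Dxy; rewrite mulrN -ef // -sumrN.
by apply: eq_bigr => r _; rewrite /grad dyN // mulNr.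
Qed.

Lemma eulerB d f g : tame D false f -> tame D false g ->
  euler d f -> euler d g -> euler d (fun x y => f x y - g x y).
Proof.
by move=> tf tg ef eg; apply: eulerD => //; [exact: tameN|exact: eulerN].
Qed.

Lemma euler_sum d (I : Type) (s : seq I) (w : I -> fn) :
  (forall i, tame D false (w i)) -> (forall i, euler d (w i)) ->
  euler d (fun x y => \sum_(i <- s) w i x y).
Proof.
move=> tw ew x y Dxy; rewrite mulr_sumr.
transitivity (\sum_r \sum_(i <- s) grad (w i) r x y * ycoord r x y).
  by apply: eq_bigr => r _; rewrite -mulr_suml -(@dy_sum _ s w r x y tw Dxy).
by rewrite exchange_big; apply: eq_bigr => i _; rewrite -ew.
Qed.

Lemma euler_dot d e u v : vtame u -> vtame v -> (forall r, euler d (u r)) ->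
  (forall r, euler e (v r)) -> euler (d + e) (dot u v).
Proof.
move=> tu tv eu ev; apply: euler_sum => r; first exact: tameM.
exact: eulerM.
Qed.

(** Differentiate Euler's identity for [f]: the derivative of the factor [ycoord] contributes one
    copy of [dy i f], which lowers the degree by one. *)
Lemma euler_dy d i f : tame D false f -> euler d f -> euler (d - 1) (dy i f).
Proof.
move=> tf ef x y Dxy.
have : dy i (dot (grad f) ycoord) x y = dy i (fun x y => d * f x y) x y.
  by apply: dy_ext => // y'; exact: ef.
rewrite dy_dot ?dyZ ?dot_dv_coord //; [|exact: vtame_grad|exact: vtame_coord].
rewrite (@dot_ext _ _ (grad (dy i f)) ycoord) // => [|r]; last exact: dyC.
by move=> /(canRL (addrK _)) ->; rewrite mulrBl mul1r.
Qed.

(** The derivative [dx i] commutes with each [dy r] and treats the coordinates $y^r$ as constants,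
    so it passes through Euler's identity. *)
Lemma euler_dx d i f : tame D true f -> euler d f -> euler d (dx i f).
Proof.
move=> tf ef x y Dxy.
have -> : d * dx i f x y = dx i (dot (grad f) ycoord) x y.
  by rewrite -dxZ //; apply/esym/dx_ext.
rewrite [LHS]/dot.
transitivity (\sum_r dx i (fun x y => grad f r x y * ycoord r x y) x y).
  apply: eq_bigr => r _; rewrite /grad -dxyC //.
  have td := tame_dy r tf.
  rewrite (pdM (dx_able i td) (dx_able i (tame_coord _ _ r)) Dxy).
  by rewrite pd_coord mulr0 add0r.
rewrite /dot; elim: (index_enum _) => [|r s IH].
  rewrite big_nil -[LHS](derive_cst (0 : R) x (delta_mx 0 i)) -(pd_fst true i _ x y).
  by apply: (@dx_ext i (fun _ _ => 0)) => // x' y' _; rewrite big_nil.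
rewrite big_cons IH.
have tgc k : tame D true (fun x y => grad f k x y * ycoord k x y).
  by apply: tameM; [exact: tame_dy|exact: tame_coord].
have ts : tame D true (fun x y => \sum_(k <- s) grad f k x y * ycoord k x y).
  exact: tame_sum.
rewrite -(pdD (dx_able i (tgc r)) (dx_able i ts) Dxy).
by apply: dx_ext => // x' y' _; rewrite big_cons.
Qed.

Lemma euler_dy' d e i f : d = e + 1 -> tame D false f -> euler d f ->
  euler e (dy i f).
Proof. by move=> -> tf ef; rewrite -(addrK 1 e); exact: euler_dy. Qed.

Lemma dot_exchange (w : 'I_n -> 'I_n -> fn) v x y :
  dot (fun h => dot (w h) v) ycoord x y =
  dot (fun r => dot (fun h => w h r) ycoord) v x y.
Proof.
rewrite /dot; under eq_bigr do rewrite mulr_suml.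
rewrite exchange_big /=; apply: eq_bigr => r _; rewrite mulr_suml.
by apply: eq_bigr => h _; rewrite mulrAC.
Qed.

Lemma dot_exchange_r u (w : 'I_n -> 'I_n -> fn) x y :
  dot (fun h => dot u (w h)) ycoord x y =
  dot u (fun r => dot (fun h => w h r) ycoord) x y.
Proof.
rewrite /dot; under eq_bigr do rewrite mulr_suml.
rewrite exchange_big /=; apply: eq_bigr => r _; rewrite mulr_sumr.
by apply: eq_bigr => h _; rewrite mulrA.
Qed.

Lemma dot_extl u u' v x y : (forall r, u r x y = u' r x y) ->
  dot u v x y = dot u' v x y.
Proof. by move=> uu; exact: dot_ext. Qed.

Lemma dotZl c u v x y : dot (fun r x y => c x y * u r x y) v x y = c x y * dot u v x y.
Proof. by rewrite /dot mulr_sumr; apply: eq_bigr => r _; rewrite mulrA. Qed.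

Lemma dotDl u u' v x y :
  dot (fun r x y => u r x y + u' r x y) v x y = dot u v x y + dot u' v x y.
Proof. by rewrite /dot -big_split; apply: eq_bigr => r _; rewrite mulrDl. Qed.

Lemma dotNl u v x y : dot (fun r x y => - u r x y) v x y = - dot u v x y.
Proof. by rewrite /dot -sumrN; apply: eq_bigr => r _; rewrite mulNr. Qed.

Lemma dot0l u v x y : (forall r, u r x y = 0) -> dot u v x y = 0.
Proof. by move=> u0; apply: big1 => r _; rewrite u0 mul0r. Qed.

Lemma dot0r u v x y : (forall r, v r x y = 0) -> dot u v x y = 0.
Proof. by move=> v0; apply: big1 => r _; rewrite v0 mulr0. Qed.

Lemma dy0 i f x y : (forall y, D x y -> f x y = 0) -> D x y -> dy i f x y = 0.
Proof. by move=> f0 Dxy; rewrite -(dy_fst i (fun=> 0) x y); exact: dy_ext. Qed.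

(** * Landsberg cubic metrics in a chart *)

Section Core.
Variables (F A : fn) (G : 'I_n -> fn).
Let L : fn := fun x y => F x y * F x y.
Let X : 'I_n -> fn := fun j => dx j L.
Let XA : 'I_n -> fn := fun j => dx j A.
Hypotheses (tF : tame D true F) (F0 : forall x y, D x y -> F x y != 0).
Hypotheses (tA : tame D true A).
Hypothesis AE : forall x y, D x y -> A x y = F x y * (F x y * F x y).
Hypothesis A3 : euler 3 A.
Hypothesis A_fst : forall i j k, exists c : 'rV[R]_n -> R, forall x y, D x y ->
  dy k (dy j (dy i A)) x y = c x.
Hypothesis L_nondeg : forall x y, D x y -> forall v : 'I_n -> R,
  (forall h, \sum_r v r * dy h (dy r L) x y = 0) -> forall r, v r = 0.
Hypothesis tG : vtame G.
(** The definition of the spray with its index lowered: as $L_{rh}=2g_{rh}$, the inverse metric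
    disappears. *)
Hypothesis spray_eq : forall h x y, D x y ->
  2 * dot G (dv h (grad L)) x y = dot (dv h X) ycoord x y - X h x y.
(** This is $4C_{ijk|0}=0$ written out with $4C_{ijk}=L_{ijk}$: the [x]-derivative, then the term of
    the nonlinear connection, then one term of the Berwald connection for each index. *)
Hypothesis landsberg_eq : forall i j k x y, D x y ->
  dot (dv k (dv i (dv j X))) ycoord x y =
    dot (fun r => dot (grad (G r)) ycoord) (dv k (dv i (dv j (grad L)))) x y
  + dot (fun h => dot (dv i (grad (G h))) ycoord) (dv k (dv j (grad L))) x y
  + dot (fun h => dot (dv j (grad (G h))) ycoord) (dv k (dv i (grad L))) x y
  + dot (fun h => dot (dv k (grad (G h))) ycoord) (dv i (dv j (grad L))) x y.

Lemma tL : tame D true L. Proof. exact: tameM. Qed.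
Lemma tL' : tame D false L. Proof. exact: tameW tL. Qed.
Lemma tA' : tame D false A. Proof. exact: tameW tA. Qed.
Lemma tX : vtame X. Proof. by move=> j; apply/tame_dx/tL. Qed.
Lemma tXA : vtame XA. Proof. by move=> j; apply/tame_dx/tA. Qed.

Ltac tm := lazymatch goal with
  | |- vtame (dv _ _) => apply: vtame_dv; tm
  | |- vtame (grad _) => apply: vtame_grad; tm
  | |- vtame G => exact: tG
  | |- vtame ycoord => exact: vtame_coord
  | |- vtame X => exact: tX
  | |- vtame XA => exact: tXA
  | |- tame _ _ (fun x y => dot ?u ?v x y) => apply: (@tame_dot u v); tm
  | |- tame _ _ (dot _ _) => apply: tame_dot; tm
  | |- tame _ _ (dv ?i ?u ?r) => apply: (@vtame_dv i u); tm
  | |- tame _ _ (grad ?f ?r) => apply: (@vtame_grad f); tm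
  | |- tame _ _ (pd false _ _) => apply: tame_dy; tm
  | |- tame _ _ (G ?i) => exact: tG
  | |- tame _ _ (X ?i) => exact: tX
  | |- tame _ _ (XA ?i) => exact: tXA
  | |- tame _ _ L => exact: tL'
  | |- tame _ _ A => exact: tA'
  | |- _ => by []
  end.

(* [lra] would otherwise compare its atoms up to conversion. *)
Ltac generalize_dots := repeat match goal with
  | |- context [dot ?u ?v ?x ?y] => move: (dot u v x y) => ?
  | |- context [dv ?i ?u ?r ?x ?y] => move: (dv i u r x y) => ?
  end.

(** * Homogeneity of [L] and of the spray *)

Lemma A4 i j k l x y : D x y -> dy l (dy k (dy j (dy i A))) x y = 0.
Proof.
have [c Ac] := A_fst i j k; move=> Dxy.
by rewrite -(dy_fst l c x y); apply: dy_ext => // y'; exact: Ac.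
Qed.

Lemma grad_sym f i h r x y : tame D false f -> D x y ->
  dv i (dv h (grad f)) r x y = dv h (dv i (grad f)) r x y.
Proof. by move=> tf Dxy; apply: dvC => //; exact: vtame_grad. Qed.

(** From $A=F^3$ and $L=F^2$: the derivatives are $3F^2F'$ and $2FF'$. This proportionality carries
    first-order identities from [L] over to [A]. *)
Lemma pd_AL s i x y : D x y -> pd s i A x y = 3 / 2 * F x y * pd s i L x y.
Proof.
move=> Dxy; have dF : pdable D s i F by exact: tame_pdable tF.
have -> : pd s i A x y = pd s i (fun x y => F x y * (F x y * F x y)) x y.
  exact: (pd_ext D_open).
rewrite (pdM dF (pdableM dF dF) Dxy) (pdM dF dF Dxy).
by field.
Qed.

Lemma L2 : euler 2 L.
Proof.
move=> x y Dxy; apply: (mulfI (x := 3 / 2 * F x y)).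
  by rewrite !mulf_neq0 ?F0 ?invr_eq0 ?pnatr_eq0.
rewrite mulrA -(dotZl (fun x y => 3 / 2 * F x y)).
transitivity (dot (grad A) ycoord x y).
  by apply: dot_ext => // r; rewrite /grad pd_AL.
by rewrite A3 // AE // /L; field.
Qed.

Lemma X2 j : euler 2 (X j). Proof. exact: euler_dx tL L2. Qed.

Lemma L2dd i r : euler 0 (dv i (grad L) r).
Proof.
by apply: (@euler_dy' 1); [rewrite add0r|tm|apply: (@euler_dy' 2) L2; [ |tm]].
Qed.

Lemma dv_spray_eq i h x y : D x y ->
  2 * (dot (dv i G) (dv h (grad L)) x y + dot G (dv i (dv h (grad L))) x y) =
  dot (dv i (dv h X)) ycoord x y + dv h X i x y - dv i X h x y.
Proof.
move=> Dxy.
have : dy i (fun x y => 2 * dot G (dv h (grad L)) x y) x y =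
    dy i (fun x y => dot (dv h X) ycoord x y - X h x y) x y.
  by apply: dy_ext => // y'; exact: spray_eq.
rewrite dyZ //; [|tm]; rewrite dyB //; [|tm|tm].
by rewrite !dy_dot //; try tm; rewrite dot_dv_coord.
Qed.

(** In $2G^rL_{rh}$, given by [spray_eq], the right-hand side has degree 2 and $L_{rh}$ has degree
    0. Hence the defect $G^r_iy^i-2G^r$ is annihilated by $L_{rh}$, which is nondegenerate. *)
Lemma G2 r : euler 2 (G r).
Proof.
move=> x y Dxy; apply/subr0_eq.
pose v r := dot (grad (G r)) ycoord x y - 2 * G r x y.
apply: (@L_nondeg x y Dxy v) => h.
have ew : euler 2 (fun x y => 2 * dot G (dv h (grad L)) x y).
  apply: (@euler_ext 2 (fun x y => dot (dv h X) ycoord x y - X h x y)).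
    by move=> x' y' Dxy'; rewrite spray_eq.
  apply: eulerB; [tm|tm| |exact: X2].
  apply: (@euler_dot 1 1); [tm|tm| |exact: euler_coord].
  by move=> k; apply: (@euler_dy' 2); [|tm|exact: X2].
have := ew x y Dxy.
rewrite (@dot_ext _ _ (fun i x y => 2 * (dot (dv i G) (dv h (grad L)) x y +
   dot G (dv i (dv h (grad L))) x y)) ycoord) //; last first.
  move=> i; have t1 : tame D false (dot G (dv h (grad L))) by tm.
  by rewrite -[LHS]/(dy i _ x y) (dyZ i 2 t1) // dy_dot //; tm.
rewrite (dotZl (fun _ _ => 2)) dotDl dot_exchange dot_exchange_r.
rewrite [X in _ + X]dot0r ?addr0 => [E|k]; last first.
  by have := @L2dd h k x y Dxy; rewrite mul0r.
have {}E := mulfI (_ : 2 != 0 :> R) E.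
rewrite /v; under eq_bigr do rewrite mulrBl -mulrA.
rewrite sumrB -mulr_sumr; apply/eqP; rewrite subr_eq0; apply/eqP.
by apply: E; rewrite pnatr_eq0.
Qed.

Lemma G2d i h x y : D x y -> dot (dv i (grad (G h))) ycoord x y = dv i G h x y.
Proof.
move=> Dxy; rewrite (@dot_ext _ _ (grad (dv i G h)) ycoord) //; last first.
  by move=> r; apply: dyC => //; tm.
by rewrite (@euler_dy' 2 1 i (G h) erefl (tG h) (@G2 h)) ?mul1r.
Qed.

Lemma G2dd i j r x y : D x y -> dot (grad (dv i (dv j G) r)) ycoord x y = 0.
Proof.
move=> Dxy; have e1 := @euler_dy' 2 1 j (G r) erefl (tG r) (@G2 r).
rewrite (@euler_dy' 1 0 i _ (esym (add0r 1)) _ e1) ?mul0r //; tm.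
Qed.

(** * The Landsberg condition as metricity of the Berwald connection *)

(** Half the sum of [dv_spray_eq] and its copy with [i] and [h] exchanged; the antisymmetric terms
    in [X] cancel. *)
Lemma sym_spray_eq i h x y : D x y ->
  2 * dot G (dv i (dv h (grad L))) x y + dot (dv i G) (dv h (grad L)) x y
  + dot (dv h G) (dv i (grad L)) x y = dot (dv i (dv h X)) ycoord x y.
Proof.
move=> Dxy; have := dv_spray_eq i h Dxy; have := dv_spray_eq h i Dxy.
rewrite (@dot_ext G (dv h (dv i (grad L))) G (dv i (dv h (grad L)))) //; last first.
  by move=> r; apply: grad_sym => //; tm.
rewrite (@dot_ext (dv h (dv i X)) ycoord (dv i (dv h X)) ycoord) //; last first.
  by move=> r; apply: dvC => //; tm.
by generalize_dots => E1 E2; lra.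
Qed.

(** This is $L_{hi|j}=0$. Differentiating [sym_spray_eq] in $y^j$ produces the contracted
    fourth-order terms of [landsberg_eq] plus one term from the derivative of [ycoord]; subtracting
    [landsberg_eq] leaves the claim. *)
Lemma metrical i h j x y : D x y ->
  dv i (dv h X) j x y = dot (dv j G) (dv i (dv h (grad L))) x y
  + dot (dv i (dv j G)) (dv h (grad L)) x y
  + dot (dv h (dv j G)) (dv i (grad L)) x y.
Proof.
move=> Dxy.
have : dy j (fun x y => 2 * dot G (dv i (dv h (grad L))) x y +
    dot (dv i G) (dv h (grad L)) x y + dot (dv h G) (dv i (grad L)) x y) x y =
    dy j (dot (dv i (dv h X)) ycoord) x y.
  by apply: dy_ext => // y'; exact: sym_spray_eq.
have t1 : tame D false (dot G (dv i (dv h (grad L)))) by tm.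
have t2 : tame D false (dot (dv i G) (dv h (grad L))) by tm.
have t3 : tame D false (dot (dv h G) (dv i (grad L))) by tm.
rewrite (dyD j (tameD (tameZ 2 t1) t2) t3 Dxy) (dyD j (tameZ 2 t1) t2 Dxy).
rewrite (dyZ j 2 t1 Dxy).
do 4!(rewrite dy_dot; [|tm|tm|done]).
rewrite dot_dv_coord.
have := landsberg_eq i h j Dxy.
rewrite (@dot_extl (fun r => dot (grad (G r)) ycoord)
  (fun r x y => 2 * G r x y) _ x y); last first.
  by move=> r; exact: G2.
rewrite (dotZl (fun _ _ => 2)).
rewrite (@dot_extl (fun h => dot (dv i (grad (G h))) ycoord) (dv i G) _ x y); last first.
  by move=> r; exact: G2d.
rewrite (@dot_extl (fun k => dot (dv h (grad (G k))) ycoord) (dv h G) _ x y); last first.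
  by move=> r; exact: G2d.
rewrite (@dot_extl (fun k => dot (dv j (grad (G k))) ycoord) (dv j G) _ x y); last first.
  by move=> r; exact: G2d.
rewrite (@dot_extl (dv j (dv i G)) (dv i (dv j G)) _ x y); last first.
  by move=> r; apply: dvC.
rewrite (@dot_extl (dv j (dv h G)) (dv h (dv j G)) _ x y); last first.
  by move=> r; apply: dvC.
by generalize_dots => E1 E2; lra.
Qed.

(** * Vanishing of the horizontal derivatives of [L] and [A] *)

(** The horizontal derivative $L_{|j}=\delta L/\delta x^j$. *)
Let Z j : fn := fun x y => X j x y - dot (dv j G) (grad L) x y.

Lemma tZ j : tame D false (Z j). Proof. by apply: tameB; tm. Qed.

(** The product rule gives $L_{hi|j}-G^r_{jhi}L_r$, and [metrical] removes the first part. *)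
Lemma Z_dd i h j x y : D x y ->
  dy i (dy h (Z j)) x y = - dot (dv i (dv h (dv j G))) (grad L) x y.
Proof.
move=> Dxy.
have t1 : tame D false (dot (dv h (dv j G)) (grad L)) by tm.
have t2 : tame D false (dot (dv j G) (dv h (grad L))) by tm.
transitivity (dy i (fun x y => dv h X j x y - (dot (dv h (dv j G)) (grad L) x y
    + dot (dv j G) (dv h (grad L)) x y)) x y).
  apply: dy_ext => // y' Dxy'; rewrite dyB //; [|tm|tm].
  by rewrite dy_dot //; tm.
rewrite dyB //; [|tm|exact: tameD].
rewrite dyD // !dy_dot //; try tm.
rewrite -[dy i _ x y]/(dv i (dv h X) j x y) metrical //.
by ring.
Qed.

Lemma Z2 j : euler 2 (Z j).
Proof.
apply: eulerB; [tm|tm|exact: X2|].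
apply: (@euler_dot 1 1); [tm|tm| |]; move=> r; apply: (@euler_dy' 2) => //; try tm.
  exact: G2.
exact: L2.
Qed.

(** The first derivative of [Z j] has degree 1, so it is the contraction of its own derivative with
    [y]. By [Z_dd] that contraction contains $G^r_{jih}y^h$, which vanishes because $G^r_{ij}$ has
    degree 0. *)
Lemma Z_d i j x y : D x y -> dy i (Z j) x y = 0.
Proof.
move=> Dxy; have := @euler_dy' 2 1 i (Z j) erefl (tZ j) (@Z2 j) x y Dxy.
rewrite mul1r => <-.
rewrite (@dot_ext _ _ (fun h x y => - dot (dv h (dv i (dv j G))) (grad L) x y) ycoord) //.
  rewrite dotNl dot_exchange dot0l ?oppr0 // => r; exact: G2dd.
by move=> h; exact: Z_dd.
Qed.

Lemma X_eq j x y : D x y -> X j x y = dot (dv j G) (grad L) x y.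
Proof.
move=> Dxy; apply/subr0_eq/(mulfI (x := 2)); first by rewrite pnatr_eq0.
by rewrite mulr0 -[LHS](@Z2 j x y) // dot0l // => i; exact: Z_d.
Qed.

(** Since [Z j] has zero derivative on the whole fibre, [Z_dd] leaves this term alone. It is the
    classical identity $y_rG^r_{jhi}=0$ of Landsberg spaces, with $y_r=\frac12L_r$. *)
Lemma G3_gradL i h j x y : D x y -> dot (dv i (dv h (dv j G))) (grad L) x y = 0.
Proof.
move=> Dxy; apply: oppr_inj; rewrite -Z_dd // oppr0; apply: dy0 => // y'.
exact: Z_d.
Qed.

Lemma dot_gradA u x y : D x y ->
  dot u (grad A) x y = 3 / 2 * F x y * dot u (grad L) x y.
Proof.
move=> Dxy; rewrite /dot mulr_sumr; apply: eq_bigr => r _.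
by rewrite /grad pd_AL //; ring.
Qed.

Lemma G3_gradA i h j x y : D x y -> dot (dv i (dv h (dv j G))) (grad A) x y = 0.
Proof. by move=> Dxy; rewrite dot_gradA // G3_gradL // mulr0. Qed.

Lemma XA_eq j x y : D x y -> XA j x y = dot (dv j G) (grad A) x y.
Proof. by move=> Dxy; rewrite dot_gradA // -X_eq // /XA pd_AL. Qed.

Lemma XA_d h j x y : D x y -> dv h XA j x y =
  dot (dv h (dv j G)) (grad A) x y + dot (dv j G) (dv h (grad A)) x y.
Proof.
move=> Dxy; rewrite -dy_dot //; try tm; apply: dy_ext => // y'; exact: XA_eq.
Qed.

(** This is $A_{hi|j}=0$: a further derivative of [XA_d], in which the third derivatives of the
    spray meet the gradient of [A] and drop out by [G3_gradA]. *)
Lemma XA_dd i h j x y : D x y -> dv i (dv h XA) j x y =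
  dot (dv h (dv j G)) (dv i (grad A)) x y
  + dot (dv i (dv j G)) (dv h (grad A)) x y
  + dot (dv j G) (dv i (dv h (grad A))) x y.
Proof.
move=> Dxy.
transitivity (dy i (fun x y => dot (dv h (dv j G)) (grad A) x y
    + dot (dv j G) (dv h (grad A)) x y) x y).
  by apply: dy_ext => // y'; exact: XA_d.
rewrite dyD //; try tm; rewrite !dy_dot //; try tm.
by rewrite G3_gradA //; ring.
Qed.

(** * The third fibre derivatives of the cubic form *)

(** One more derivative of [XA_dd] splits into [S], where third derivatives of the spray meet
    $A_{rs}$, and [T], where the Berwald coefficients meet $A_{rst}$. *)
Let S k h i : 'I_n -> fn := fun j x y =>
  dot (dv k (dv h (dv j G))) (dv i (grad A)) x y
  + dot (dv k (dv i (dv j G))) (dv h (grad A)) x y.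

Let T k h i : 'I_n -> fn := fun j x y =>
  dot (dv h (dv j G)) (dv k (dv i (grad A))) x y
  + dot (dv i (dv j G)) (dv k (dv h (grad A))) x y
  + dot (dv k (dv j G)) (dv i (dv h (grad A))) x y.

Lemma tS k h i : vtame (S k h i).
Proof. by move=> j; apply: tameD; tm. Qed.

Lemma tT k h i : vtame (T k h i).
Proof. by move=> j; apply: tameD; [apply: tameD|]; tm. Qed.

Lemma dot_A4 u i h k x y : D x y -> dot u (dv k (dv i (dv h (grad A)))) x y = 0.
Proof. by move=> Dxy; apply: dot0r => r; exact: A4. Qed.

Lemma XA_ddd k i h j x y : D x y ->
  dv k (dv i (dv h XA)) j x y = S k h i j x y + T k h i j x y.
Proof.
move=> Dxy.
have t1 : tame D false (dot (dv h (dv j G)) (dv i (grad A))) by tm.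
have t2 : tame D false (dot (dv i (dv j G)) (dv h (grad A))) by tm.
have t3 : tame D false (dot (dv j G) (dv i (dv h (grad A)))) by tm.
transitivity (dy k (fun x y => dot (dv h (dv j G)) (dv i (grad A)) x y
  + dot (dv i (dv j G)) (dv h (grad A)) x y
  + dot (dv j G) (dv i (dv h (grad A))) x y) x y).
  by apply: dy_ext => // y'; exact: XA_dd.
rewrite (dyD k (tameD t1 t2) t3 Dxy) (dyD k t1 t2 Dxy).
do 3!(rewrite dy_dot; [|tm|tm|done]).
by rewrite dot_A4 // /S /T; ring.
Qed.

(** The four [y]-derivatives move inside the [x]-derivative one by one, and there they annihilate
    the cubic [A]. *)
Lemma XA_dddd m k i h j x y : D x y -> dv m (dv k (dv i (dv h XA))) j x y = 0.
Proof.
move=> Dxy.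
have t1 := tame_dy h tA; have t2 := tame_dy i t1; have t3 := tame_dy k t2.
transitivity (dx j (dy m (dy k (dy i (dy h A)))) x y).
  rewrite (dxyC j m t3 Dxy); apply: dy_ext => // y3 D3.
  rewrite (dxyC j k t2 D3); apply: dy_ext => // y2 D2.
  rewrite (dxyC j i t1 D2); apply: dy_ext => // y1 D1.
  by rewrite (dxyC j h tA D1).
transitivity (dx j (fun _ _ => 0) x y).
  by apply: dx_ext => // x' y'; exact: A4.
by rewrite (pd_fst true j (fun=> 0)) derive_cst.
Qed.

Lemma G3C m h j r x y : D x y ->
  dv m (dv h (dv j G)) r x y = dv j (dv m (dv h G)) r x y.
Proof. by move=> Dxy; rewrite dvC' // dvC //; tm. Qed.

(** By symmetry the derivative in $y^j$ can be taken last; it then acts on a function of degree 0,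
    and Euler's identity applies. *)
Lemma G3_coord m h v x y : D x y ->
  dot (fun j => dot (dv m (dv h (dv j G))) v) ycoord x y = 0.
Proof.
move=> Dxy; rewrite dot_exchange; apply: dot0l => r.
rewrite (@dot_ext _ _ (grad (dv m (dv h G) r)) ycoord) ?G2dd // => j.
by rewrite G3C.
Qed.

Lemma S_coord k h i x y : D x y -> dot (S k h i) ycoord x y = 0.
Proof. by move=> Dxy; rewrite dotDl !G3_coord // addr0. Qed.

(** The derivative falls on the connection only, as the fourth derivatives of [A] vanish, and every
    remaining term is covered by [G3_coord]. *)
Lemma T_d_coord m k h i x y : D x y -> dot (dv m (T k h i)) ycoord x y = 0.
Proof.
move=> Dxy.
rewrite (@dot_ext _ _ (fun j x y =>
    dot (dv m (dv h (dv j G))) (dv k (dv i (grad A))) x y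
  + dot (dv m (dv i (dv j G))) (dv k (dv h (grad A))) x y
  + dot (dv m (dv k (dv j G))) (dv i (dv h (grad A))) x y) ycoord) //.
  by rewrite !dotDl !G3_coord // !addr0.
move=> j.
have t1 : tame D false (dot (dv h (dv j G)) (dv k (dv i (grad A)))) by tm.
have t2 : tame D false (dot (dv i (dv j G)) (dv k (dv h (grad A)))) by tm.
have t3 : tame D false (dot (dv k (dv j G)) (dv i (dv h (grad A)))) by tm.
rewrite [LHS](dyD m (tameD t1 t2) t3 Dxy) (dyD m t1 t2 Dxy).
do 3!(rewrite dy_dot; [|tm|tm|done]).
by rewrite !dot_A4 // !addr0.
Qed.

(* Contracting with [y] after one more [y]-derivative: [T] has degree [0] and
   the left-hand side of [XA_ddd] does not depend on [y], so only the
   derivative of the factor [y^j] in [S_coord] survives. *)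
Lemma S0 m k h i x y : D x y -> S k h i m x y = 0.
Proof.
move=> Dxy; have := dy0 m (fun y' => @S_coord k h i x y') Dxy.
rewrite dy_dot //; [|exact: tS|tm]; rewrite dot_dv_coord => E.
suff dS : dot (dv m (S k h i)) ycoord x y = 0 by rewrite dS add0r in E.
rewrite -[RHS]oppr0 -(T_d_coord m k h i Dxy) -dotNl; apply: dot_ext => // j.
have : dy m (fun x y => S k h i j x y + T k h i j x y) x y = 0.
  rewrite -[RHS](XA_dddd m k i h j Dxy); apply: dy_ext => // y' Dxy'.
  by rewrite XA_ddd.
rewrite dyD //; [|exact: tS|exact: tT].
by move/(canRL (addrK _)); rewrite sub0r.
Qed.

(** If $v^rA_{rh}=0$, contraction with $y^h$ gives $v^rA_r=0$, hence $v^rL_r=0$. Then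
    $A_{rh}=\frac32(F_hL_r+FL_{rh})$ leaves $v^rL_{rh}=0$, and [L_nondeg] applies. *)
Lemma A_nondeg x y : D x y -> forall v : 'I_n -> R,
  (forall h, \sum_r v r * dv h (grad A) r x y = 0) -> forall r, v r = 0.
Proof.
move=> Dxy v vA; pose w : 'I_n -> fn := fun r _ _ => v r.
have A2 r : euler 2 (grad A r) by apply: (@euler_dy' 3) => //; [ring|tm].
have vA1 : dot w (grad A) x y = 0.
  apply: (mulfI (_ : 2 != 0 :> R)); first by rewrite pnatr_eq0.
  have : dot (fun h => dot w (dv h (grad A))) ycoord x y = 0.
    by apply: dot0l => h; exact: vA.
  rewrite dot_exchange_r mulr0 => <-.
  transitivity (dot w (fun r x y => 2 * grad A r x y) x y).
    by rewrite /dot mulr_sumr; apply: eq_bigr => r _; ring.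
  by apply: dot_ext => // r; rewrite -(A2 r x y Dxy).
have FF : 3 / 2 * F x y != 0 by rewrite !mulf_neq0 ?F0 ?invr_eq0 ?pnatr_eq0.
have vL1 : dot w (grad L) x y = 0.
  by apply: (mulfI FF); rewrite -dot_gradA // vA1 mulr0.
apply: (L_nondeg Dxy) => h; apply: (mulfI FF); rewrite mulr0 -[RHS](vA h).
have tF' := tameW tF.
transitivity (3 / 2 * dy h F x y * dot w (grad L) x y
   + 3 / 2 * F x y * dot w (dv h (grad L)) x y).
  by rewrite vL1 mulr0 add0r.
rewrite /dot !mulr_sumr -big_split; apply: eq_bigr => r _ /=.
have -> : dv h (grad A) r x y = dy h (fun x y => 3 / 2 * F x y * grad L r x y) x y.
  by apply: dy_ext => // y' Dxy'; rewrite /grad pd_AL.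
rewrite (dyM h (tameZ (3 / 2) tF')) //; last tm.
by rewrite dyZ // /w /dv; ring.
Qed.

(** The left-hand side and the third derivatives of [A] are constant along the fibre, so this is a
    linear system for the Berwald coefficients that is the same at every [y] over [x]. *)
Lemma XA_ddd_eq k i h j x y : D x y -> dv k (dv i (dv h XA)) j x y =
  dot (dv h (dv j G)) (dv k (dv i (grad A))) x y
  + dot (dv i (dv j G)) (dv k (dv h (grad A))) x y
  + dot (dv k (dv j G)) (dv i (dv h (grad A))) x y.
Proof. by move=> Dxy; rewrite XA_ddd // S0 // add0r. Qed.

(** * Comparison of the connection at two points of a fibre *)

Lemma A_ddd_fst k i r x y0 y : D x y0 -> D x y ->
  dv k (dv i (grad A)) r x y0 = dv k (dv i (grad A)) r x y.
Proof. by move=> D0 Dxy; have [c Ac] := A_fst r i k; rewrite /dv /grad !Ac. Qed.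

Lemma XA_ddd_fst k i h j x y0 y : D x y0 -> D x y ->
  dv k (dv i (dv h XA)) j x y0 = dv k (dv i (dv h XA)) j x y.
Proof.
have t1 := tame_dy h tA; have t2 := tame_dy i t1.
have [c Ac] := A_fst h i k.
suff E y' : D x y' -> dv k (dv i (dv h XA)) j x y' = 'D_(delta_mx 0 j) c x.
  by move=> D0 Dxy; rewrite !E.
move=> Dy'; rewrite -(pd_fst true j c x y').
transitivity (dx j (dy k (dy i (dy h A))) x y'); last by apply: dx_ext.
rewrite (dxyC j k t2 Dy'); apply: dy_ext => // y2 D2.
rewrite (dxyC j i t1 D2); apply: dy_ext => // y1 D1.
by rewrite (dxyC j h tA D1).
Qed.

(* The difference of two values of the connection at [x] leaves the cubic form
   infinitesimally invariant, so its quadratic form vanishes at [y]. *)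
Lemma spray_quadratic x y0 y r : D x y0 -> D x y ->
  \sum_j (\sum_h dv h (dv j G) r x y0 * y 0 h) * y 0 j = 2 * G r x y.
Proof.
move=> D0 Dxy.
(* Contraction with the vector [y], also for values taken at [y0]; [ctC] permutes two
   contractions. *)
pose ct (f : 'I_n -> R) := \sum_a f a * y 0 a.
have ctE (f g : 'I_n -> R) : f =1 g -> ct f = ct g.
  by move=> fg; apply: eq_bigr => a _; rewrite fg.
have ctD (f g : 'I_n -> R) : ct (fun a => f a + g a) = ct f + ct g.
  by rewrite /ct -big_split; apply: eq_bigr => a _; rewrite mulrDl.
have ctC (f : 'I_n -> 'I_n -> R) : ct (fun a => ct (f a)) = ct (fun b => ct (f^~ b)).
  rewrite /ct; under eq_bigr do rewrite mulr_suml.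
  rewrite exchange_big /=; apply: eq_bigr => b _; rewrite mulr_suml.
  by apply: eq_bigr => a _; rewrite mulrAC.
have ct_sum (u : 'I_n -> 'I_n -> R) (v : 'I_n -> R) :
    ct (fun a => \sum_s u a s * v s) = \sum_s ct (u^~ s) * v s.
  rewrite /ct; under eq_bigr do rewrite mulr_suml.
  rewrite exchange_big /=; apply: eq_bigr => s _; rewrite mulr_suml.
  by apply: eq_bigr => a _; rewrite mulrAC.
have ct_sumr (v : 'I_n -> R) (u : 'I_n -> 'I_n -> R) :
    ct (fun a => \sum_s v s * u a s) = \sum_s v s * ct (u^~ s).
  rewrite /ct; under eq_bigr do rewrite mulr_suml.
  rewrite exchange_big /=; apply: eq_bigr => s _; rewrite mulr_sumr.
  by apply: eq_bigr => a _; rewrite mulrA.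
(* With $D$ the difference of the two connections, [dl j h s] is $D^s_{jh}$ and [e j h k i] is
   $D^s_{jh}A_{sik}$. *)
pose dl j h s := dv h (dv j G) s x y0 - dv h (dv j G) s x y.
pose e j h k i := \sum_s dl j h s * dv k (dv i (grad A)) s x y.
have e12 j h k i : e j h k i = e h j k i.
  apply: eq_bigr => s _; congr (_ * _).
  by rewrite /dl (dvC h j s tG D0) (dvC h j s tG Dxy).
(* The difference of [XA_ddd_eq] at [y0] and at [y]. *)
have cyc j h k i : e j h k i + e j i k h + e j k i h = 0.
  have := XA_ddd_fst k i h j D0 Dxy; rewrite !XA_ddd_eq //.
  move/eqP; rewrite -subr_eq0 => /eqP <-.
  have tE p q u : dot u (dv p (dv q (grad A))) x y0 =
      \sum_s u s x y0 * dv p (dv q (grad A)) s x y.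
    by apply: eq_bigr => s _; rewrite (@A_ddd_fst p q s x y0 y).
  have eE a b p q : e a b p q = dot (dv b (dv a G)) (dv p (dv q (grad A))) x y0
      - dot (dv b (dv a G)) (dv p (dv q (grad A))) x y.
    by rewrite tE -sumrB; apply: eq_bigr => s _; rewrite -mulrBl.
  by rewrite !eE; ring.
(* Contracting [h], [k] and [i] makes the three terms of [cyc] equal, so three times this value is
   zero. *)
have V0 j : ct (fun h => ct (fun k => ct (fun i => e j h k i))) = 0.
  set V := LHS.
  have V2 : ct (fun h => ct (fun k => ct (fun i => e j i k h))) = V.
    rewrite [LHS]ctC /V; transitivity (ct (fun k => ct (fun h => ct (fun i => e j h k i)))).
      by apply/ctE => k; rewrite ctC.
    by rewrite ctC.
  have V3 : ct (fun h => ct (fun k => ct (fun i => e j k i h))) = V.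
    by rewrite [LHS]ctC; apply/ctE => h; rewrite [LHS]ctC.
  have : V + V + V = 0.
    rewrite -{2}V2 -{2}V3 -!ctD -[RHS](_ : ct (fun=> 0) = 0); last first.
      by rewrite /ct big1 // => a _; rewrite mul0r.
    apply/ctE => h; rewrite -!ctD /ct big1 // => k _.
    rewrite -!big_split big1 ?mul0r // => i _ /=.
    by rewrite -!mulrDl cyc mul0r.
  by move: V {V2 V3} => V; lra.
(* With [k] free, the first two terms of [cyc] coincide after contraction, and the third vanishes by
   [V0] and the symmetry [e12]. *)
have U0 k : ct (fun i => ct (fun j => ct (fun h => e j h k i))) = 0.
  set U := LHS.
  have U2 : ct (fun i => ct (fun j => ct (fun h => e j i k h))) = U.
    by rewrite /U ctC [RHS]ctC; apply/ctE => j; rewrite ctC.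
  have : U + U + ct (fun i => ct (fun j => ct (fun h => e j k i h))) = 0.
    rewrite -{2}U2 -!ctD -[RHS](_ : ct (fun=> 0) = 0); last first.
      by rewrite /ct big1 // => a _; rewrite mul0r.
    apply/ctE => i; rewrite -!ctD /ct big1 // => j _.
    rewrite -!big_split big1 ?mul0r // => h _ /=.
    by rewrite -!mulrDl cyc mul0r.
  have -> : ct (fun i => ct (fun j => ct (fun h => e j k i h))) = 0.
    rewrite -(V0 k) ctC; apply/ctE => j; apply/ctE => i; apply/ctE => h.
    exact: e12.
  by move: U {U2} => U; lra.
pose w s := ct (fun j => ct (fun h => dl j h s)).
have w0 : w r = 0.
  (* Euler's identity turns $A_{ski}y^i$ into $A_{sk}$, so [U0] puts [w] in the kernel of the
     nondegenerate $A_{sk}$. *)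
  apply: (A_nondeg Dxy) => k; rewrite -[RHS](U0 k).
  transitivity (ct (fun i => \sum_s w s * dv k (dv i (grad A)) s x y)).
    rewrite ct_sumr; apply: eq_bigr => s _; congr (_ * _).
    have e2 : euler 2 (grad A s) by apply: (@euler_dy' 3) => //; [ring|tm].
    have e1 : euler 1 (dy k (grad A s)) by apply: (@euler_dy' 2) => //; tm.
    rewrite -[LHS]mul1r -[LHS](e1 x y Dxy); apply: eq_bigr => i _.
    congr (_ * _); rewrite /grad dyC //; tm.
  apply/ctE => i; rewrite -ct_sum; apply/ctE => j.
  by rewrite -ct_sum.
have e1 j : euler 1 (dy j (G r)) by apply: (@euler_dy' 2) => //; exact: G2.
have : w r = ct (fun j => ct (fun h => dv h (dv j G) r x y0)) - 2 * G r x y.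
  rewrite -(@G2 r x y Dxy) /w.
  transitivity (ct (fun j => ct (fun h => dv h (dv j G) r x y0) - grad (G r) j x y)).
    apply/ctE => j; rewrite -[grad (G r) j x y]mul1r -(e1 j x y Dxy).
    by rewrite /ct /dot -sumrB; apply: eq_bigr => h _; rewrite -mulrBl.
  by rewrite {1}/ct /dot -sumrB; apply: eq_bigr => h _; rewrite -mulrBl.
by rewrite w0 => /esym /subr0_eq.
Qed.

(** By [spray_quadratic], $2G^r$ is on this fibre a quadratic form in [y] with coefficients frozen
    at [y0]; two derivatives recover twice those coefficients. *)
Lemma connection_fst i k r x y0 y : D x y0 -> D x y ->
  dv i (dv k G) r x y = dv i (dv k G) r x y0.
Proof.
move=> D0 Dxy; pose b h j : fn := fun _ _ => dv h (dv j G) r x y0.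
have tb h j : tame D false (b h j) by exact: tame_cst.
have tbc j : tame D false (dot (b^~ j) ycoord) by apply: tame_dot => //; tm.
have tbc' : vtame (fun j => dot (b^~ j) ycoord) by [].
have tbv h : vtame (b h) by [].
have tbv' h : vtame (b^~ h) by [].
have db m h j : dy m (b h j) =2 fun _ _ => 0.
  by move=> x' y'; rewrite (dy_fst m (fun=> dv h (dv j G) r x y0)).
have dbc m j x' y' : D x' y' -> dy m (dot (b^~ j) ycoord) x' y' = b m j x' y'.
  move=> Dxy'; rewrite dy_dot //; last tm.
  by rewrite dot_dv_coord dot0l ?add0r // => h; exact: db.
have E1 m x' y' : D x' y' -> dy m (dot (fun j => dot (b^~ j) ycoord) ycoord) x' y' =
    dot (b m) ycoord x' y' + dot (b^~ m) ycoord x' y'.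
  move=> Dxy'; rewrite dy_dot //; last tm.
  rewrite dot_dv_coord; congr (_ + _); apply: dot_ext => // j; exact: dbc.
have E2 : dy i (dy k (dot (fun j => dot (b^~ j) ycoord) ycoord)) x y =
    dy i (dy k (fun x y => 2 * G r x y)) x y.
  apply: dy_ext => // y1 D1; apply: dy_ext => // y2 D2.
  exact: spray_quadratic.
have E3 : dy i (dy k (dot (fun j => dot (b^~ j) ycoord) ycoord)) x y =
    dv i (dv k G) r x y0 + dv i (dv k G) r x y0.
  transitivity (dy i (fun x y => dot (b k) ycoord x y + dot (b^~ k) ycoord x y) x y).
    by apply: dy_ext => // y1; exact: E1.
  rewrite dyD //; last by apply: tame_dot => //; tm.
  rewrite dbc // dy_dot //; last tm.
  rewrite dot_dv_coord dot0l ?add0r => [|h]; last exact: db.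
  by rewrite /b (dvC k i r tG D0).
have E4 : dy i (dy k (fun x y => 2 * G r x y)) x y = 2 * dv i (dv k G) r x y.
  rewrite -dyZ //; last tm.
  by apply: dy_ext => // y1 D1; rewrite dyZ.
move: E2; rewrite E3 E4; generalize_dots => E; lra.
Qed.

End Core.
End TameCalculus.

(** * The spray and the Landsberg equation *)

Section Instance.
Context {R : realType} {n : nat}.
Variable D : 'rV[R]_n -> set 'rV[R]_n.
Hypothesis D_open : open [set z : 'rV[R]_n * 'rV[R]_n | D z.1 z.2].
Local Notation fn := ('rV[R]_n -> 'rV[R]_n -> R).
Local Notation dx := (@pd R n true).
Local Notation dy := (@pd R n false).

(** * Polynomial dependence on [y] *)

(** Degree at most [d] in [y], read off from derivatives: any [d] of them leave a function of [x].
    For the cubic form this is the shape required by [A_fst]. *)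
Fixpoint ydeg (d : nat) (f : fn) : Prop :=
  tame D true f /\
  match d with
  | 0%N => exists c : 'rV[R]_n -> R, forall x y, D x y -> f x y = c x
  | d'.+1 => forall m, ydeg d' (dy m f)
  end.

Lemma ydeg_tame d f : ydeg d f -> tame D true f.
Proof. by case: d => [|d] []. Qed.

Lemma ydeg_ext d f g : (forall x y, D x y -> f x y = g x y) -> ydeg d f -> ydeg d g.
Proof.
elim: d f g => [|d IH] f g fg [tf df]; split; try exact: tame_ext fg tf.
  by have [c fc] := df; exists c => x y Dxy; rewrite -fg // fc.
move=> m; apply: IH (df m) => x y Dxy.
by apply: (dy_ext D_open) => // y'; exact: fg.
Qed.

Lemma ydegD d f g : ydeg d f -> ydeg d g -> ydeg d (fun x y => f x y + g x y).
Proof.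
elim: d f g => [|d IH] f g [tf df] [tg dg]; split; try exact: tameD.
  have [c fc] := df; have [e ge] := dg.
  by exists (fun x => c x + e x) => x y Dxy; rewrite fc // ge.
move=> m; apply: ydeg_ext (IH _ _ (df m) (dg m)) => x y Dxy.
by rewrite (dyD D_open m (tameW tf) (tameW tg) Dxy).
Qed.

Lemma ydeg0 d : ydeg d (fun _ _ => 0).
Proof.
elim: d => [|d IH]; split; try exact: tame_cst; first by exists (fun=> 0).
by move=> m; apply: ydeg_ext IH => x y _; rewrite (dy_fst m (fun=> 0)).
Qed.

Lemma ydeg_sum d (I : Type) (s : seq I) (w : I -> fn) :
  (forall i, ydeg d (w i)) -> ydeg d (fun x y => \sum_(i <- s) w i x y).
Proof.
move=> dw; elim: s => [|i s IH].
  by apply: ydeg_ext (ydeg0 d) => x y _; rewrite big_nil.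
by apply: ydeg_ext (ydegD (dw i) IH) => x y _; rewrite big_cons.
Qed.

Lemma ydegM_coord d f i : ydeg d f -> ydeg d.+1 (fun x y => f x y * y 0 i).
Proof.
have tc : tame D true (fun _ y => y 0 i) by exact: tame_coord.
have fZ (b : bool) (g : fn) e : ydeg e g -> ydeg e (fun x y => g x y * b%:R).
  move=> eg; case: b.
    by apply: ydeg_ext eg => x y _; rewrite mulr1.
  by apply: ydeg_ext (ydeg0 e) => x y _; rewrite mulr0.
have dM m g x y : tame D true g -> D x y -> dy m (fun x y => g x y * y 0 i) x y =
    dy m g x y * y 0 i + g x y * (i == m)%:R.
  by move=> tg Dxy; rewrite (dyM D_open m (tameW tg) (tameW tc) Dxy) pd_coord.
elim: d f => [|d IH] f [tf df]; split; try exact: tameM.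
  move=> m; apply: (ydeg_ext (f := fun x y => f x y * (i == m)%:R)); last first.
    by apply: (fZ _ _ 0%N).
  move=> x y Dxy; rewrite dM //; have [c fc] := df.
  rewrite [dy m f x y](_ : _ = 0) ?mul0r ?add0r // -(dy_fst m c x y).
  by apply: (dy_ext D_open) => // y'; exact: fc.
move=> m; apply: ydeg_ext (ydegD (IH _ (df m)) (fZ (i == m) f d.+1 (conj tf df))).
by move=> x y Dxy; rewrite dM.
Qed.

Variables (F : fn) (a : 'I_n -> 'I_n -> 'I_n -> 'rV[R]_n -> R).
Let A : fn := fun x y =>
  \sum_i \sum_j \sum_k a i j k x * y 0 i * y 0 j * y 0 k.
Hypothesis a_derivable : forall i j k l x y, D x y ->
  derivable (a i j k) x (delta_mx 0 l).
Hypothesis F_cubic : forall x y, D x y -> F x y = cbrt (A x y).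
Hypothesis F0 : forall x y, D x y -> F x y != 0.
Hypothesis F_unit : forall x y, D x y -> metric F x y \in unitmx.
Hypothesis F_landsberg : forall x y, D x y -> forall i j k : 'I_n,
  \sum_l cartan_hcov F i j k l x y * y 0 l = 0.

Lemma ydeg_cubic : ydeg 3 A.
Proof.
do 3![apply: ydeg_sum => ?]; do 3!apply: ydegM_coord.
split; last by eexists; reflexivity.
by apply: tame_fst => _ x y Dxy l; exact: a_derivable Dxy.
Qed.

Lemma euler_cubic : euler D 3 A.
Proof.
have ta i j k : tame D false (fun x _ => a i j k x) by exact: tame_fst.
have tc i : tame D false (fun _ y => y 0 i) by exact: tame_coord.
have -> : 3 = 0 + 1 + 1 + 1 :> R by ring.
apply: (euler_sum D_open) => i; first by do 2![apply: tame_sum => ?]; repeat apply: tameM.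
apply: (euler_sum D_open) => j; first by apply: tame_sum => ?; repeat apply: tameM.
apply: (euler_sum D_open) => k; first by repeat apply: tameM.
apply: (eulerM D_open); [by repeat apply: tameM|exact: tc| |exact: euler_coord].
apply: (eulerM D_open); [by repeat apply: tameM|exact: tc| |exact: euler_coord].
apply: (eulerM D_open); [exact: ta|exact: tc| |exact: euler_coord].
exact: euler_fst.
Qed.

Lemma cubic_neq0 x y : D x y -> A x y != 0.
Proof.
move=> Dxy; apply: contra_neq (F0 Dxy) => A0.
by rewrite F_cubic // A0 /cbrt sgr0 mul0r.
Qed.

(** Regularity of [F] in [x] comes from the coefficients: a Finsler space postulates smoothness in
    [y] only. *)
Lemma tame_F : tame D true F.
Proof.
apply: tame_ext (tame_cbrt cubic_neq0 (ydeg_tame ydeg_cubic)) => x y Dxy.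
by rewrite F_cubic.
Qed.

(** * The spray and Landsberg equations in terms of [L] *)

Let L : fn := fun x y => F x y * F x y.
Let X : 'I_n -> fn := fun j => dx j L.

Lemma pdyE : @pdy R n = dy.
Proof. by rewrite pd.unlock. Qed.

Lemma pdxE : @pdx R n = dx.
Proof. by rewrite pd.unlock. Qed.

Lemma metricE x y : metric F x y = \matrix_(i, j) (2^-1 * dy i (dy j L) x y).
Proof. by rewrite /metric pdyE. Qed.

Lemma tame_L : tame D true L.
Proof. exact: tameM tame_F tame_F. Qed.

Lemma L_nondeg x y : D x y -> forall v : 'I_n -> R,
  (forall h, \sum_r v r * dy h (dy r L) x y = 0) -> forall r, v r = 0.
Proof.
move=> Dxy v vL r; pose w := \col_s v s.
suff : w = 0 by move/colP/(_ r); rewrite !mxE.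
rewrite -[w](mulKmx (F_unit Dxy)) (_ : metric F x y *m w = 0) ?mulmx0 //.
apply/colP => h; rewrite metricE !mxE.
transitivity (2^-1 * \sum_r v r * dy h (dy r L) x y); last by rewrite vL mulr0.
by rewrite mulr_sumr; apply: eq_bigr => s _; rewrite !mxE; ring.
Qed.

Let w h : fn := fun x y => dot (dv h X) (@ycoord R n) x y - X h x y.

Lemma sprayE r x y :
  spray F r x y = 4^-1 * \sum_h inv_metric F x y r h * w h x y.
Proof.
rewrite /spray mulrA -invfM -natrM; congr (_ * _); apply: eq_bigr => h _.
by rewrite pdyE pdxE.
Qed.

Lemma tame_w h : tame D false (w h).
Proof.
have tX : vtame D X by move=> j; apply: (tame_dx D_open); exact: tame_L.
apply: tameB => //; apply: tame_dot; last exact: vtame_coord.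
exact: (vtame_dv D_open).
Qed.

Lemma tame_spray r : tame D false (spray F r).
Proof.
have tg i j : tame D false (fun x y => 2^-1 * dy i (dy j L) x y).
  by apply: tameZ; do 2!apply: (tame_dy D_open); exact: tameW tame_L.
have gu x y : D x y -> \matrix_(i, j) (2^-1 * dy i (dy j L) x y) \in unitmx.
  by rewrite -metricE; exact: F_unit.
apply: (tame_ext (f := fun x y => 4^-1 * \sum_h
    invmx (\matrix_(i, j) (2^-1 * dy i (dy j L) x y)) r h * w h x y)).
  by move=> x y _; rewrite sprayE /inv_metric metricE.
apply: tameZ; apply: tame_sum => h.
by apply: tameM (tame_w h); exact: (tame_invmx tg gu).
Qed.

(** Multiply [sprayE] by the metric: $2L_{rh}=4g_{rh}$ cancels the inverse metric and the factor
    [4^-1]. *)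
Lemma spray_lower h x y : D x y ->
  2 * dot (spray F) (dv h (grad L)) x y = w h x y.
Proof.
move=> Dxy; pose u := \col_k w k x y.
have E : metric F x y *m (invmx (metric F x y) *m u) = u by rewrite mulKVmx ?F_unit.
have := congr1 (fun m : 'cV_n => m h 0) E; rewrite [RHS]mxE => <-.
rewrite mxE mulr_sumr; apply: eq_bigr => r _.
rewrite sprayE metricE mxE [in RHS]mxE /inv_metric metricE /dv /grad.
under [in RHS]eq_bigr do rewrite [u _ _]mxE.
by move: (\sum_(_ < _) _) (dy _ _ _ _) => s d; field.
Qed.

Lemma cartanE i j k x y : D x y -> cartan F i j k x y = 4^-1 * dy k (dy i (dy j L)) x y.
Proof.
move=> Dxy; rewrite /cartan pdyE.
rewrite (_ : (fun x' y' => metric F x' y' i j) = fun x y => 2^-1 * dy i (dy j L) x y).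
  rewrite (dyZ D_open) //; first by rewrite mulrA -invfM -natrM.
  by do 2!apply: (tame_dy D_open); exact: tameW tame_L.
by apply/funext => x'; apply/funext => y'; rewrite metricE mxE.
Qed.

Lemma landsberg_contracted i j k x y : D x y ->
  dot (dv k (dv i (dv j X))) (@ycoord R n) x y =
    dot (fun r => dot (grad (spray F r)) (@ycoord R n)) (dv k (dv i (dv j (grad L)))) x y
  + dot (fun h => dot (dv i (grad (spray F h))) (@ycoord R n)) (dv k (dv j (grad L))) x y
  + dot (fun h => dot (dv j (grad (spray F h))) (@ycoord R n)) (dv k (dv i (grad L))) x y
  + dot (fun h => dot (dv k (grad (spray F h))) (@ycoord R n)) (dv i (dv j (grad L))) x y.
Proof.
move=> Dxy; have t0 := tame_L; have t0' := tameW t0.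
have t1 m := tame_dy D_open m t0; have t2 m l := tame_dy D_open m (t1 l).
have t3 m l r := tame_dy D_open m (t2 l r).
have Ex l : dx l (cartan F i j k) x y = 4^-1 * dv k (dv i (dv j X)) l x y.
  transitivity (dx l (fun x y => 4^-1 * dy k (dy i (dy j L)) x y) x y).
    by apply: (dx_ext D_open) => // x' y'; exact: cartanE.
  rewrite (dxZ D_open) //; congr (_ * _).
  rewrite (dxyC D_open l k (t2 i j) Dxy); apply: (dy_ext D_open) => // y2 D2.
  rewrite (dxyC D_open l i (t1 j) D2); apply: (dy_ext D_open) => // y1 D1.
  by rewrite (dxyC D_open l j t0 D1).
(* Symmetry of the third derivatives of [L] brings the Cartan tensor with [h] in its first or second
   place to the form with [h] innermost. *)
have sym3 p q r : dy p (dy q (dy r L)) x y = dy p (dy r (dy q L)) x y.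
  by apply: (dy_ext D_open) => // y' Dy'; rewrite (dyC D_open) //.
have sym3' p q r : dy p (dy q (dy r L)) x y = dy q (dy p (dy r L)) x y.
  by rewrite (dyC D_open) //; exact: tameW (t1 r).
have Ey r : dy r (cartan F i j k) x y = 4^-1 * dv k (dv i (dv j (grad L))) r x y.
  transitivity (dy r (fun x y => 4^-1 * dy k (dy i (dy j L)) x y) x y).
    by apply: (dy_ext D_open) => // y'; exact: cartanE.
  rewrite (dyZ D_open) //; last exact: tameW (t3 k i j).
  rewrite /dv /grad (dyC D_open r k (tameW (t2 i j)) Dxy).
  congr (_ * _); apply: (dy_ext D_open) => // y2 D2.
  rewrite (dyC D_open r i (tameW (t1 j)) D2); apply: (dy_ext D_open) => // y1 D1.
  by rewrite (dyC D_open r j t0' D1).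
have := F_landsberg Dxy i j k.
under eq_bigr => l _ do
  rewrite /cartan_hcov /horizontal_deriv /nonlin_conn /berwald_conn
    pdxE pdyE Ex !mulrBl.
rewrite !sumrB.
have S1 : \sum_l 4^-1 * dv k (dv i (dv j X)) l x y * y 0 l =
   4^-1 * dot (dv k (dv i (dv j X))) (@ycoord R n) x y.
  by rewrite /dot mulr_sumr; apply: eq_bigr => l _; rewrite mulrA.
(* Common shape of the four connection terms: exchanging the sums over [h] and [l] contracts the
   connection with [y] first. *)
have S2 (c : 'I_n -> R) (v : 'I_n -> fn) (g : 'I_n -> 'I_n -> fn) :
    (forall h, c h = 4^-1 * v h x y) ->
    \sum_l (\sum_h g h l x y * c h) * y 0 l =
    4^-1 * dot (fun h => dot (g h) (@ycoord R n)) v x y.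
  move=> cv; rewrite /dot mulr_sumr; under eq_bigr do rewrite mulr_suml.
  rewrite exchange_big /=; apply: eq_bigr => h _.
  rewrite mulr_suml mulr_sumr; apply: eq_bigr => l _.
  by rewrite cv /ycoord; ring.
rewrite S1 (S2 _ (dv k (dv i (dv j (grad L)))) (fun r => grad (spray F r))) //.
rewrite (S2 _ (dv k (dv j (grad L))) (fun h => dv i (grad (spray F h)))); last first.
  by move=> h; rewrite cartanE //; congr (_ * _); rewrite /dv /grad sym3.
rewrite (S2 _ (dv k (dv i (grad L))) (fun h => dv j (grad (spray F h)))); last first.
  by move=> h; rewrite cartanE.
rewrite (S2 _ (dv i (dv j (grad L))) (fun h => dv k (grad (spray F h)))); last first.
  by move=> h; rewrite cartanE //; congr (_ * _); rewrite /dv /grad sym3' sym3 // sym3'.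
move: (dot _ _ x y) (dot _ _ x y) (dot _ _ x y) (dot _ _ x y) (dot _ _ x y).
by move=> q1 q2 q3 q4 q5 E; lra.
Qed.

Lemma berwald_conn_fst i j k x y0 y : D x y0 -> D x y ->
  berwald_conn F i j k x y = berwald_conn F i j k x y0.
Proof.
rewrite /berwald_conn pdyE => D0 Dxy.
apply: (connection_fst D_open tame_F F0 (ydeg_tame ydeg_cubic) _ euler_cubic _
  L_nondeg tame_spray _ landsberg_contracted j k i D0 Dxy).
- by move=> x' y' Dxy'; rewrite -expr2 -exprS F_cubic // cbrt_cube.
- move=> i' j' k'; have [_ /(_ i')[_ /(_ j')[_ /(_ k')[_ [c Ec]]]]] := ydeg_cubic.
  by exists c.
- by move=> h x' y'; exact: spray_lower.
Qed.

End Instance.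

Theorem proposition5 (R : realType) (n : nat) (M : smooth_manifold R n)
    (F : finsler_space M)
    (a : chart R n M -> 'I_n -> 'I_n -> 'I_n -> 'rV[R]_n -> R)
    (a_sym : coef_symmetric a) (a_C1 : coef_C1 a) (F_cubic : cubic_metric F a) :
  landsberg F -> berwald F.
Proof.
move=> landsbergF c atc i j k.
(* The witness evaluates the connection at an arbitrarily chosen direction over [x]. Any [y] in the
   same fibre gives the same value, and also shows that the fibre is nonempty, so that [get] lands
   in it. *)
exists (fun x => berwald_conn (ffun F c) i j k x (get (fdom F c x))) => x y Dxy.
apply: (berwald_conn_fst (fdom_open (f := F) atc) (a := a c)) => //.
- move=> i' j' k' l x' y' Dxy'.
  have [_ /(_ l)[da _]] := a_C1 c atc i' j' k'.
  by apply: da; have [] := fdom_slit atc Dxy'.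
- exact: F_cubic.
- exact: ffun_neq0.
- exact: ffun_nondegenerate.
- exact: landsbergF.
- exact: getPex (ex_intro _ y Dxy).
Qed.
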